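(* Let $d\in\mathbb{N}$, let $\varepsilon>0$, and let $\varphi\colon(0,1)\to[0,d]$ be such that $\varphi$ is increasing and $\theta\mapsto(1-\theta)\varphi(\theta)$ is decreasing. Then there is a compact set $F\subset\mathbb{R}^d$ such that the function $\phi(\theta)=\dim_{\mathrm{A}}^{\theta}F$ is non-monotonic on every non-empty open subset of $(0,1)$ and $\lVert\phi-\varphi\rVert_\infty<\varepsilon$.
   Context: ''Increasing'' and ''decreasing'' are meant in the non-strict sense; $\lVert\cdot\rVert_\infty$ is the supremum norm over $(0,1)$. $\mathbb{R}^d$ carries the Euclidean norm and $B(x,\delta)$ is the open ball of centre $x$ and radius $\delta$. For bounded $E\subset\mathbb{R}^d$ and $\delta>0$, $N_\delta(E)$ is the least number of balls of radius $\delta$ required to cover $E$. For $\theta\in(0,1)$ the Assouad spectrum of $F\subset\mathbb{R}^d$ is $$\dim_{\mathrm{A}}^{\theta}F=\inf\Bigl\{\alpha:(\exists C>0)(\forall\, 0<\delta\leq 1)(\forall x\in F)\ N_{\delta^{1/\theta}}(F\cap B(x,\delta))\leq C\Bigl(\frac{\delta}{\delta^{1/\theta}}\Bigr)^{\alpha}\Bigr\}.$$ *)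

(* Defs.v *)
From HB Require Import structures.
From mathcomp Require Import all_boot all_order all_algebra.
From mathcomp Require Import all_classical all_reals all_analysis.

Set Implicit Arguments.
Unset Strict Implicit.
Unset Printing Implicit Defensive.

Import Order.TTheory GRing.Theory Num.Theory.
Import numFieldNormedType.Exports.

Local Open Scope classical_set_scope.
Local Open Scope ring_scope.

(* The norm and the balls that the library puts on 'rV[R]_d are those of the
   maximum norm, hence the Euclidean versions below; the topology is the same. *)
Definition euclid_norm {R : realType} {d : nat} (x : 'rV[R]_d) : R :=
  Num.sqrt (\sum_(i < d) x ord0 i ^+ 2).

Definition euclid_ball {R : realType} {d : nat} (x : 'rV[R]_d) (delta : R)
  : set 'rV[R]_d := [set y | euclid_norm (y - x) < delta].

(* Centres may lie outside E. The value is +oo if no finite cover exists, which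
   does not happen for bounded E and delta > 0; otherwise the infimum is
   attained. *)
Definition covering_number {R : realType} {d : nat} (delta : R)
    (E : set 'rV[R]_d) : \bar R :=
  ereal_inf [set n%:R%:E | n in [set n : nat |
    exists c : 'I_n -> 'rV[R]_d,
      E `<=` \bigcup_(i in [set: 'I_n]) euclid_ball (c i) delta]].

(* The infimum is taken in \bar R over all real alpha; it is -oo for F empty. *)
Definition assouad_spectrum {R : realType} {d : nat} (F : set 'rV[R]_d)
    (theta : R) : \bar R :=
  ereal_inf [set alpha%:E | alpha in [set alpha : R |
    exists2 C : R, 0 < C &
      forall delta : R, 0 < delta -> delta <= 1 ->
      forall x : 'rV[R]_d, F x ->
        (covering_number (delta `^ theta^-1) (F `&` euclid_ball x delta)
           <= (C * (delta / delta `^ theta^-1) `^ alpha)%:E)%E]].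

Definition monotone_on {R : realType} (U : set R) (f : R -> \bar R) : Prop :=
  {in U &, nondecreasing_fun f} \/ {in U &, nonincreasing_fun f}.

Definition sup_norm01 {R : realType} (f : R -> \bar R) : \bar R :=
  ereal_sup [set `|f theta|%E | theta in `]0, 1[].

(* Main.v *)
Require Import Defs.
From HB Require Import structures.
From mathcomp Require Import all_boot all_order all_algebra.
From mathcomp Require Import all_classical all_reals all_analysis.
From mathcomp Require Import ring lra zify.

Import Order.TTheory GRing.Theory Num.Theory.
Import numFieldNormedType.Exports.

Local Open Scope classical_set_scope.
Local Open Scope ring_scope.

(** Write [k x = (1 - x) f x].  If [k] is nonincreasing and [d]-Lipschitz and
    satisfies [k (theta t) <= k t + t k theta], then [f] is an Assouad spectrum:
    in dimension [d] take a set of binary expansions in which [a m <= d] coordinates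
    have a free digit number [m], the partial sums of [a] following the rescaled
    graph of [- k] on the blocks of an enormously sparse sequence of scales and
    being constant on the blocks in between.  A location at scale [2^-p] contains
    about [2^(a p + ... + a (q-1))] pieces of size [2^-q], and the inequality for
    [k] says exactly that the windows [theta q, q] ending at the end of a block
    are the worst ones.

    For [f] take [c phi (g x) + a (g x) + 2 a - eta (x^2/2 - x^3/3)] with [c]
    close to 1, a small constant [a] (not the digit counts above) and
    [eta = a/6], where [g x] is [x] minus the length of
    [A `&` [0, x]] for a small set [A] such that both [A] and its complement have
    intervals of relative density close to 1 inside every interval.  Where [A] is
    dense [g] is almost constant and the last term makes [f] decrease; where the
    complement is dense [g] has slope almost 1 and [f] increases.  At the
    macroscopic scale [f] still increases, by an amount which dominates all its
    local decreases, and this yields the inequality for [k]. *)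

(** * Lipschitz functions of Lebesgue measure that oscillate everywhere *)

Lemma injective_unbounded (s : nat -> nat) (N : nat) :
  injective s -> exists n, (N <= s n)%N.
Proof.
move=> sI; apply: contrapT => /forallNP h.
have lt n : (s n < N)%N by rewrite ltnNge; apply/negP/h.
have gI : injective (fun i : 'I_N.+1 => Ordinal (lt i)).
  by move=> i j /(congr1 val) /= /sI /val_inj.
by have := leq_card _ gI; rewrite !card_ord ltnn.
Qed.

(** The third component of a decoded triple makes every pair of a rational and a flag recur at
    infinitely many indices, hence beyond any [N]. *)
Lemma exists_recurrent_dense_sequence (R : realType) :
  exists (q : nat -> R) (ty : nat -> bool), forall (a b : R) (t : bool) (N : nat),
    a < b -> exists k, [/\ (N <= k)%N, a < q k < b & ty k = t].
Proof.
pose dec k : rat * bool * nat := odflt (0, false, 0%N) (unpickle k).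
exists (fun k => ratr (dec k).1.1), (fun k => (dec k).1.2) => a b t N ab.
have [u] := rat_in_itvoo ab; rewrite in_itv/= => uab.
have sI : injective (fun n : nat => pickle ((u, t, n) : rat * bool * nat)).
  by move=> m n /(pcan_inj (@pickleK _)) [].
have [n nN] := injective_unbounded _ N sI.
by exists (pickle ((u, t, n) : rat * bool * nat)); rewrite /dec pickleK.
Qed.

Lemma exists_half_exp_le (R : realType) (e : R) : 0 < e ->
  exists N, forall k, (N <= k)%N -> 2^-1 ^+ k <= e.
Proof.
move=> e0; have [N Ne] : exists N, e^-1 < N%:R.
  by exists (Num.bound e^-1); rewrite archi_boundP// invr_ge0 ltW.
exists N => k Nk; rewrite exprVn invf_ple ?posrE ?exprn_gt0//.
apply: (le_trans (ltW Ne)); rewrite -natrX ler_nat.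
by apply: (leq_trans Nk); apply: ltnW; apply: ltn_expl.
Qed.

Lemma lebesgue_measure_bigcup_le (R : realType) (B : nat -> set R) (S : set R)
    (c : R) : 0 <= c -> (forall i, measurable (B i)) -> measurable S ->
  S `<=` \bigcup_i B i ->
  (forall i, (lebesgue_measure (B i) <= (c * 2^-1 ^+ i.+1)%:E)%E) ->
  (lebesgue_measure S <= c%:E)%E.
Proof.
move=> c0 mB mS SB hB.
apply: (le_trans (measure_sigma_subadditive lebesgue_measure mB mS SB)).
apply: le_trans (epsilon_trick0 xpredT c0).
apply: lee_nneseries => // i _; apply: (le_trans (hB i)).
by rewrite lee_fin natrX exprVn.
Qed.

Section oscillating_measure.
Variables (R : realType) (r : R) (r0 : 0 < r) (q : nat -> R) (ty : nat -> bool).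
Hypothesis qty : forall (a b : R) (t : bool) (N : nat),
    a < b -> exists k, [/\ (N <= k)%N, a < q k < b & ty k = t].

Local Notation mu := (@lebesgue_measure R).

Variable rho : nat -> R.
Hypothesis rho_gt0 : forall k, 0 < rho k.
Hypothesis rho_le : forall k, rho k <= r / 4 * 2^-1 ^+ k.
Hypothesis rho_tail :
  forall k i, rho (k.+1 + i)%N <= rho k * 2^-1 ^+ k * 2^-1 ^+ i.+1.

(** The factor [y * (1 - y)] thins the neighbourhoods near 0 and 1; this is where the factor
    [y * (1 - x)] in [mu_A] comes from. *)
Let nbhd k : set R := [set y | `|y - q k| < rho k * (y * (1 - y))].

Let measurable_nbhd k : measurable (nbhd k).
Proof.
have -> : nbhd k =
    (fun y : R => `|y - q k| - rho k * (y * (1 - y))) @^-1` `]-oo, 0[%classic.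
  by apply/seteqP; split => y /=; rewrite /nbhd /= in_itv/= subr_lt0.
rewrite -[X in measurable X]setTI.
apply: measurable_realfun.continuous_measurable_fun => //.
move=> y; apply: cvgB; first by apply: cvg_norm; apply: cvgB => //; exact: cvg_cst.
apply: cvgM; first exact: cvg_cst.
apply: cvgM => //.
by apply: cvgB => //; exact: cvg_cst.
Qed.

Let later k : set R := \bigcup_i nbhd (k.+1 + i)%N.

Let measurable_later k : measurable (later k).
Proof. exact: bigcup_measurable. Qed.

(** Later neighbourhoods overrule earlier ones: a point lying in at least one and only finitely many
    of them belongs to [A] iff the last of these has a true flag. *)
Let A : set R := \bigcup_(k in [set k | ty k]) (nbhd k `\` later k).

Let measurable_A : measurable A.
Proof. by apply: bigcup_measurable => k _; apply: measurableD. Qed.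

Let mu_le_itv (S : set R) (a b : R) : a <= b -> measurable S ->
  S `<=` `[a, b]%classic -> (mu S <= (b - a)%:E)%E.
Proof.
move=> ab mS Sab; apply: (@le_trans _ _ (mu `[a, b]%classic)).
  by apply: le_measure => //; rewrite inE.
rewrite lebesgue_measure_itv/= lte_fin.
by case: ifP => //; rewrite lee_fin; lra.
Qed.

Let mu_nbhd k x y : 0 <= x <= y -> y <= 1 ->
  (mu (nbhd k `&` `]x, y]) <= (2 * rho k * (y * (1 - x)))%:E)%E.
Proof.
move=> xy y1; have := rho_gt0 k => rk.
have c0 : 0 <= rho k * (y * (1 - x)).
  by apply: mulr_ge0; [exact: ltW | apply: mulr_ge0; lra].
have -> : 2 * rho k * (y * (1 - x)) =
    (q k + rho k * (y * (1 - x))) - (q k - rho k * (y * (1 - x))) by ring.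
apply: mu_le_itv; [lra | exact: measurableI | ].
move=> z /= [zk]; rewrite in_itv/= => zxy.
have : `|z - q k| <= rho k * (y * (1 - x)).
  apply: (le_trans (ltW zk)); rewrite ler_pM2l//.
  by rewrite ler_pM//; lra.
by rewrite ler_norml in_itv/=; lra.
Qed.

(** By [rho_tail] the lengths of the later neighbourhoods sum geometrically to a fraction of order
    [2^-1 ^+ k] of [rho k], which is negligible for large [k]. *)
Let mu_later k x y : 0 <= x <= y -> y <= 1 ->
  (mu (later k `&` `]x, y]) <= (2 * rho k * 2^-1 ^+ k)%:E)%E.
Proof.
move=> xy y1; have rk := rho_gt0 k.
apply: (@lebesgue_measure_bigcup_le _ (fun i => nbhd (k.+1 + i)%N `&` `]x, y]%classic)).
- by rewrite !mulr_ge0// ltW.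
- by move=> i; exact: measurableI.
- exact: measurableI.
- by rewrite -setI_bigcupl.
- move=> i; apply: (le_trans (mu_nbhd _ _ _ xy y1)); rewrite lee_fin.
  have := rho_tail k i; have := rho_gt0 (k.+1 + i).
  move: (rho (k.+1 + i)) => u u0 hu.
  have : u * (y * (1 - x)) <= u by rewrite ler_piMr ?mulr_ile1//; lra.
  lra.
Qed.

Let mu_A x y : 0 <= x <= y -> y <= 1 ->
  (mu (A `&` `]x, y]) <= (r * (y * (1 - x)))%:E)%E.
Proof.
move=> xy y1.
have m0 : 0 <= y * (1 - x) by rewrite mulr_ge0//; lra.
apply: (@lebesgue_measure_bigcup_le _ (fun i => nbhd i `&` `]x, y]%classic)).
- by rewrite mulr_ge0// ltW.
- by move=> i; exact: measurableI.
- exact: measurableI.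
- by rewrite -setI_bigcupl; apply: setSI => z [k _ [zk _]]; exists k.
- move=> i; apply: (le_trans (mu_nbhd _ _ _ xy y1)); rewrite lee_fin.
  rewrite exprS.
  have -> : r * (y * (1 - x)) * (2^-1 * 2^-1 ^+ i) =
            2 * (r / 4 * 2^-1 ^+ i) * (y * (1 - x)) by field.
  by rewrite ler_wpM2r// ler_pM2l//; exact: rho_le.
Qed.

Let W x : R := fine (mu (A `&` `]0, x])).

Let fin_mu (S : set R) x y : x <= y -> measurable S -> S `<=` `]x, y]%classic ->
  mu S \is a fin_num.
Proof.
move=> xy mS Sxy; rewrite ge0_fin_numE//.
apply: (@le_lt_trans _ _ (y - x)%:E); last exact: ltry.
apply: mu_le_itv => // z /Sxy /=; rewrite !in_itv/=; lra.
Qed.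

Let W_diff x y : 0 <= x <= y -> W y - W x = fine (mu (A `&` `]x, y])).
Proof.
move=> xy; rewrite /W.
have -> : A `&` `]0, y]%classic = (A `&` `]0, x]) `|` (A `&` `]x, y]).
  rewrite -setIUr; congr (_ `&` _); apply/seteqP; split => z /=; rewrite !in_itv/=.
    by have [] := leP z x; [left | right]; lra.
  by move=> []; lra.
have f1 : mu (A `&` `]0, x]%classic) \is a fin_num.
  by apply: (fin_mu _ 0 x) => //; [lra | exact: measurableI].
have f2 : mu (A `&` `]x, y]%classic) \is a fin_num.
  by apply: (fin_mu _ x y) => //; [lra | exact: measurableI].
rewrite measureU; [|exact: measurableI|exact: measurableI|].
  rewrite (fineD f1 f2); move: (fine _) (fine _) => u v.
  by rewrite addrAC subrr add0r.
by apply/seteqP; split => z //= [[_ +] [_]]; rewrite !in_itv/=; lra.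
Qed.

Let fine_mu_le (S : set R) (c : R) : 0 <= c -> (mu S <= c%:E)%E -> fine (mu S) <= c.
Proof.
move=> c0 Sc; rewrite -lee_fin fineK// ge0_fin_numE//.
by apply: (le_lt_trans Sc); exact: ltry.
Qed.

Let W_diff_compl x y : 0 <= x <= y ->
  y - x - (W y - W x) = fine (mu (`]x, y] `\` A)).
Proof.
move=> xy; rewrite W_diff//.
have E : mu `]x, y]%classic = (y - x)%:E.
  rewrite lebesgue_measure_itv/= lte_fin; case: ifPn => // h.
  by congr EFin; lra.
have f1 : mu (`]x, y]%classic `&` A) \is a fin_num.
  by apply: (fin_mu _ x y); [lra | exact: measurableI | move=> z []].
have f2 : mu (`]x, y]%classic `\` A) \is a fin_num.
  by apply: (fin_mu _ x y); [lra | exact: measurableD | move=> z []].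
have DI : mu `]x, y]%classic =
    (mu (`]x, y]%classic `\` A) + mu (`]x, y]%classic `&` A))%E.
  by apply: measureDI => //; exact: measurable_A.
move: DI; rewrite E => /(congr1 fine); rewrite (fineD f2 f1) (setIC A) /=.
by move: (fine _) (fine _) => u v ->; rewrite addrK.
Qed.

(* On a short interval around [q k] the set [A] agrees with [nbhd k] (if [ty k])
   or with its complement (if not) up to [later k], and [later k] is much
   shorter than the interval. *)
Let W_steep (t : bool) (a b z : R) : 0 <= a -> a < b -> b <= 1 -> 0 < z ->
  exists x y, [/\ a < x, x < y, y < b &
    if t then (1 - z) * (y - x) <= W y - W x else W y - W x <= z * (y - x)].
Proof.
move=> a0 ab b1 z0.
pose e := (b - a) / 8; have e0 : 0 < e by rewrite /e; lra.
(* [m] bounds [y * (1 - y)] from below on [[a + e, b - e]], so the interval of half-length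
   [s = rho k * m / 2] around [q k] lies inside [nbhd k]. *)
pose m := (a + e) * (1 - (b - e)).
have m0 : 0 < m by rewrite /m mulr_gt0 /e//; lra.
have m1 : m <= 1 by rewrite /m mulr_ile1 /e//; lra.
have e1 : 0 < z * m / 2 by rewrite divr_gt0// mulr_gt0.
have e2 : 0 < e / r by rewrite divr_gt0.
have [N1 hN1] := exists_half_exp_le _ _ e1.
have [N2 hN2] := exists_half_exp_le _ _ e2.
have ab' : a + 2 * e < b - 2 * e by rewrite /e; lra.
have [k [kN qk tyk]] := qty _ _ t (maxn N1 N2) ab'.
have {}hN1 := hN1 k (leq_trans (leq_maxl _ _) kN).
have {}hN2 := hN2 k (leq_trans (leq_maxr _ _) kN).
have rk0 := rho_gt0 k.
pose s := rho k * m / 2.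
have s0 : 0 < s by rewrite /s divr_gt0// mulr_gt0.
have rm : rho k * m <= rho k by rewrite ler_piMr// ltW.
have rke : rho k <= e.
  apply: (le_trans (rho_le k)).
  have : r * 2^-1 ^+ k <= r * (e / r) by rewrite ler_pM2l.
  by rewrite mulrCA divff ?gt_eqF// mulr1; lra.
have se : s <= e / 2 by rewrite /s; lra.
have sub z' : q k - s < z' <= q k + s -> nbhd k z'.
  move=> hz; rewrite /nbhd /=.
  apply: (@le_lt_trans _ _ s); first by rewrite ler_norml; lra.
  have : rho k * m <= rho k * (z' * (1 - z')).
    have z1 : a + e <= z' by lra.
    have z2 : 1 - (b - e) <= 1 - z' by lra.
    by rewrite ler_pM2l// ler_pM//; rewrite /e; lra.
  by rewrite /s; move: (mulr_gt0 rk0 m0); lra.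
have bnd : 2 * rho k * 2^-1 ^+ k <= z * (2 * s).
  have : rho k * 2^-1 ^+ k <= rho k * (z * m / 2) by rewrite ler_pM2l.
  by rewrite /s; lra.
have xy : 0 <= q k - s <= q k + s by lra.
have y1 : q k + s <= 1 by lra.
have sE : (q k + s) - (q k - s) = 2 * s by ring.
have zs0 : 0 <= z * (2 * s).
  by apply: mulr_ge0; [exact: ltW | apply: mulr_ge0 => //; exact: ltW].
have L (S : set R) : measurable S -> S `<=` later k `&` `](q k - s), (q k + s)]%classic ->
    fine (mu S) <= z * (2 * s).
  move=> mS Sl; apply: fine_mu_le => //.
  apply: (@le_trans _ _ (2 * rho k * 2^-1 ^+ k)%:E); last by rewrite lee_fin.
  apply: le_trans (mu_later k _ _ xy y1).
  apply: le_measure => //; rewrite inE; first exact: mS.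
  exact: (measurableI _ _ (measurable_later k) (measurable_itv _)).
exists (q k - s), (q k + s); split.
- by lra.
- by lra.
- by lra.
rewrite sE; case: t tyk => tyk.
  suff : 2 * s - (W (q k + s) - W (q k - s)) <= z * (2 * s) by lra.
  rewrite -sE W_diff_compl// sE; apply: L; first exact: measurableD.
  move=> u [hu nA]; split=> //; apply: contrapT => nl; apply: nA.
  by exists k => //; split=> //; apply: sub; move: hu; rewrite /= in_itv.
rewrite W_diff//; apply: L; first exact: measurableI.
move=> u [[j /= tyj [uj nl] hu]]; split=> //.
have uk : nbhd k u by apply: sub; move: hu; rewrite /= in_itv.
(* An index [j < k] is impossible, since then [u] in [nbhd k] would lie in [later j]; [j = k] is
   excluded by the flag. *)
have [jk|kj|jk] := ltngtP j k.
- by exfalso; apply: nl; exists (k - j.+1)%N => //; rewrite subnKC.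
- by exists (j - k.+1)%N => //; rewrite subnKC.
- by rewrite jk tyk in tyj.
Qed.

Lemma oscillating_measure_aux : exists W : R -> R, [/\ W 0 = 0,
  forall x y, 0 <= x -> x <= y -> y <= 1 -> 0 <= W y - W x <= y - x,
  forall x y, 0 <= x -> x <= y -> y <= 1 -> W y - W x <= r * (y * (1 - x)) &
  forall (t : bool) (a b z : R), 0 <= a -> a < b -> b <= 1 -> 0 < z ->
  exists x y, [/\ a < x, x < y, y < b &
    if t then (1 - z) * (y - x) <= W y - W x else W y - W x <= z * (y - x)]].
Proof.
exists W; split.
- by rewrite /W set_itv_ge ?setI0 ?measure0//= bnd_simp ltxx.
- move=> x y x0 xy y1; have xy' : 0 <= x <= y by rewrite x0.
  rewrite W_diff// fine_ge0//=; apply: fine_mu_le; first by lra.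
  apply: mu_le_itv => //; first exact: measurableI.
  by move=> z [_] /=; rewrite !in_itv/=; lra.
- move=> x y x0 xy y1; have xy' : 0 <= x <= y by rewrite x0.
  rewrite W_diff//; apply: fine_mu_le; last exact: mu_A.
  by have h := r0; rewrite !mulr_ge0//; lra.
- exact: W_steep.
Qed.

End oscillating_measure.

Lemma exists_oscillating_measure (R : realType) (r : R) : 0 < r ->
  exists W : R -> R, [/\ W 0 = 0,
  forall x y, 0 <= x -> x <= y -> y <= 1 -> 0 <= W y - W x <= y - x,
  forall x y, 0 <= x -> x <= y -> y <= 1 -> W y - W x <= r * (y * (1 - x)) &
  forall (t : bool) (a b z : R), 0 <= a -> a < b -> b <= 1 -> 0 < z ->
  exists x y, [/\ a < x, x < y, y < b &
    if t then (1 - z) * (y - x) <= W y - W x else W y - W x <= z * (y - x)]].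
Proof.
move=> r0; have [q [ty qty]] := exists_recurrent_dense_sequence R.
have r4 : 0 < r / 4 by lra.
(* The square in the exponent yields [rho_tail], because [(k + 1 + i)^2] is at least
   [k^2 + k + i + 1]. *)
apply: (@oscillating_measure_aux _ _ r0 _ _ qty (fun k => r / 4 * 2^-1 ^+ (k * k))).
- by move=> k /=; rewrite mulr_gt0// exprn_gt0.
- move=> k /=; rewrite ler_pM2l//; apply: ler_wiXn2l; [lra | lra | nia].
- move=> k i /=; rewrite -[leRHS]mulrA -[leRHS]mulrA ler_pM2l// -!exprD.
  by apply: ler_wiXn2l; [lra | lra | nia].
Qed.

(** * The profile *)

(** Since [(1 - t) + (t - x) = 1 - x], the claim compares [f x] with a weighted mean of [f t] and
    [f theta]. As [theta * t = r ^+ 2], one of the two points is at least [r] and gains [c] there;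
    the loss at the other is at most [c] times its distance from [x], and the weights make the gain
    prevail. *)
Lemma window_inequality (R : realFieldType) (f : R -> R) (x t theta c r : R) :
  0 < t < 1 -> 0 < theta < 1 -> x = theta * t -> 0 <= r -> r ^+ 2 = x ->
  0 <= c ->
  (forall y, r <= y < 1 -> c <= f y - f x) ->
  (forall y, x < y < 1 -> f x - f y <= c * (y - x)) ->
  (1 - x) * f x <= (1 - t) * f t + t * ((1 - theta) * f theta).
Proof.
move=> /andP[t0 t1] /andP[h0 h1] xE r0 rE c0 big small.
have xt : x < t by rewrite xE; nra.
have xh : x < theta by rewrite xE; nra.
suff : 0 <= (1 - t) * (f t - f x) + (t - x) * (f theta - f x).
  by rewrite xE; lra.
have [rt|tr] := leP r t.
  have H1 := big t; rewrite rt t1 in H1; have {}H1 := H1 isT.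
  have H2 := small theta; rewrite xh h1 in H2; have {}H2 := H2 isT.
  have E1 : theta - x = theta * (1 - t) by rewrite xE; ring.
  have E2 : t - x = t * (1 - theta) by rewrite xE; ring.
  rewrite E1 in H2; rewrite E2.
  have A1 : (1 - t) * c <= (1 - t) * (f t - f x) by rewrite ler_wpM2l //; lra.
  have A2 : t * (1 - theta) * (- (c * (theta * (1 - t)))) <=
    t * (1 - theta) * (f theta - f x).
    by rewrite ler_wpM2l ?mulr_ge0//; lra.
  have A3 : 0 <= (1 - t) * c * (1 - t * (1 - theta) * theta).
    rewrite mulr_ge0// ?mulr_ge0//; [lra|].
    have tt : t * (1 - theta) <= 1 by clear -t0 t1 h0 h1; rewrite mulr_ile1//; lra.
    have t0' : 0 <= t * (1 - theta) by rewrite mulr_ge0 ?subr_ge0// ltW.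
    by rewrite subr_ge0 mulr_ile1// ltW.
  lra.
have rh : r <= theta.
  rewrite leNgt; apply/negP => hr.
  have : theta * t < r ^+ 2 by nra.
  by rewrite rE xE ltxx.
have H1 := big theta; rewrite rh h1 in H1; have {}H1 := H1 isT.
have H2 := small t; rewrite xt t1 in H2; have {}H2 := H2 isT.
have A1 : (t - x) * c <= (t - x) * (f theta - f x) by rewrite ler_wpM2l //; lra.
have A2 : (1 - t) * (- (c * (t - x))) <= (1 - t) * (f t - f x).
  by rewrite ler_wpM2l //; lra.
have A3 : 0 <= (t - x) * c * t by rewrite !mulr_ge0//; lra.
lra.
Qed.

Section concave_primitive.
Variable R : realFieldType.
Implicit Types x y : R.

(* A primitive of [x * (1 - x)]. *)
Definition bump_primitive x : R := x ^+ 2 / 2 - x ^+ 3 / 3.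

(** The integrand is at most [y * (1 - x)] on [[x, y]]. *)
Lemma bump_primitive_le x y : 0 <= x -> x <= y -> y <= 1 ->
  bump_primitive y - bump_primitive x <= (y - x) * (y * (1 - x)).
Proof.
move=> x0 xy y1; rewrite -subr_ge0 /bump_primitive.
have -> : (y - x) * (y * (1 - x)) -
    (y ^+ 2 / 2 - y ^+ 3 / 3 - (x ^+ 2 / 2 - x ^+ 3 / 3)) =
  (y - x) * ((y - x) / 2 + (y - x) ^+ 2 / 3) by field.
by apply: mulr_ge0; [lra | have := sqr_ge0 (y - x); lra].
Qed.

Lemma bump_primitive_lip x y : 0 <= x -> x <= y -> y <= 1 ->
  bump_primitive y - bump_primitive x <= y - x.
Proof.
move=> x0 xy y1; apply: (le_trans (bump_primitive_le x y x0 xy y1)).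
by rewrite ler_piMr ?subr_ge0// mulr_ile1//; lra.
Qed.

(** The trapezoid rule for the concave integrand would give [1 / 2] in place of [1 / 3]; with
    [1 / 3] the remainder is a sum of products that are visibly nonnegative. *)
Lemma bump_primitive_ge x y : 0 <= x -> x <= y -> y <= 1 ->
  (y - x) * ((x * (1 - x) + y * (1 - y)) / 3) <= bump_primitive y - bump_primitive x.
Proof.
move=> x0 xy y1; rewrite -subr_ge0 /bump_primitive.
have -> : y ^+ 2 / 2 - y ^+ 3 / 3 - (x ^+ 2 / 2 - x ^+ 3 / 3) -
  (y - x) * ((x * (1 - x) + y * (1 - y)) / 3) =
  (y - x) * ((x * (1 - y) + y * (1 - x)) / 6) by field.
have h1 : 0 <= x * (1 - y) by apply: mulr_ge0; lra.
have h2 : 0 <= y * (1 - x) by apply: mulr_ge0; lra.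
by apply: mulr_ge0; lra.
Qed.

Lemma bump_slope_ge (u v x : R) : 0 <= u -> u <= x -> x <= v -> v <= 1 ->
  u * (1 - v) <= x * (1 - x).
Proof. by move=> u0 ux xv v1; rewrite ler_pM//; lra. Qed.

Lemma bump_primitive_homo x y : 0 <= x -> x <= y -> y <= 1 ->
  bump_primitive x <= bump_primitive y.
Proof.
move=> x0 xy y1; rewrite -subr_ge0; apply: le_trans (bump_primitive_ge x y x0 xy y1).
have h1 : 0 <= x * (1 - x) by apply: mulr_ge0; lra.
have h2 : 0 <= y * (1 - y) by apply: mulr_ge0; lra.
by apply: mulr_ge0; lra.
Qed.

Lemma bump_primitive_itv x : 0 <= x <= 1 -> 0 <= bump_primitive x <= 1 / 6.
Proof.
move=> /andP[x0 x1]; have := bump_primitive_homo 0 x (lexx _) x0 x1.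
have := bump_primitive_homo x 1 x0 x1 (lexx _).
by rewrite /bump_primitive !expr0n !expr1n/=; lra.
Qed.

End concave_primitive.

(** From some [s0] on, [phi] is within [e] of its supremum. Before [s0], the decrease of
    [(1 - x) * phi x] bounds the growth of [phi] by a Lipschitz constant. *)
Lemma left_uniformly_close (R : realType) (D e : R) (phi : R -> R) :
  0 < D -> 0 < e ->
  (forall x, 0 < x < 1 -> 0 <= phi x <= D) ->
  (forall x y, 0 < x -> x <= y -> y < 1 -> phi x <= phi y) ->
  (forall x y, 0 < x -> x <= y -> y < 1 -> (1 - y) * phi y <= (1 - x) * phi x) ->
  exists2 r, 0 < r <= 1 / 4 &
    forall x y, 0 < y -> y <= x -> x < 1 -> x - y <= r -> phi x - phi y <= e.
Proof.
move=> D0 e0 phiD phi_up phi_down.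
have [s0 s01 hs0] : exists2 s, 0 < s < 1 & forall x, 0 < x < 1 -> phi x <= phi s + e.
  apply: contrapT => h.
  pose E := [set phi x | x in [set x | 0 < x < 1]].
  have E1 : has_sup E.
    split; first by exists (phi 2^-1), 2^-1 => //=; lra.
    by exists D => _ [x x01 <-]; have /andP[] := phiD _ x01.
  have [_ [s s01 <-] hs] := sup_adherent e0 E1.
  apply: h; exists s => // x x01.
  have : phi x <= sup E by apply: sup_ubound => //; [case: E1 | exists x].
  by move: hs; lra.
(* The second bound keeps [1 - x] above [(1 - s0) / 2] when [y < s0]; the third makes the Lipschitz
   growth over a length [r] at most [e]. *)
pose r := Num.min (1 / 4) (Num.min ((1 - s0) / 2) (e * (1 - s0) / (2 * D))).
have es : 0 < e * (1 - s0) by rewrite mulr_gt0//; lra.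
have r1 : r <= 1 / 4 by rewrite /r ge_min lexx.
have r2 : r <= (1 - s0) / 2 by rewrite /r !ge_min lexx /= orbT.
have r3 : r <= e * (1 - s0) / (2 * D) by rewrite /r !ge_min lexx !orbT.
exists r.
  rewrite r1 andbT /r !lt_min; apply/and3P; split; [lra|lra|].
  by rewrite divr_gt0// mulr_gt0.
move=> x y y0 yx x1 xyr.
have [ys|sy] := leP s0 y.
  have := hs0 x; have := phi_up s0 y.
  by move=> /(_ ltac:(lra) ys ltac:(lra)) h1 /(_ ltac:(lra)); lra.
have D1 : r * D <= e * (1 - s0) / 2.
  have -> : e * (1 - s0) / 2 = e * (1 - s0) / (2 * D) * D by field; rewrite gt_eqF.
  by rewrite ler_pM2r.
have h1 := phi_down y x y0 yx x1.
have /andP[p0 pD] := phiD y ltac:(lra).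
have h2 : (x - y) * phi y <= r * D by rewrite ler_pM//; lra.
have h3 : e * (1 - s0) / 2 <= e * (1 - x) by rewrite -mulrA ler_pM2l//; lra.
have h4 : (1 - x) * (phi x - phi y) <= (1 - x) * e by lra.
by move: h4; rewrite ler_pM2l//; lra.
Qed.

Section profile.
Variables (R : realType) (D e a r : R) (phi W : R -> R).
Hypotheses (D1 : 1 <= D) (a0 : 0 < a) (aD : 4 * a <= D) (r0 : 0 < r) (r1 : r <= 1 / 4).
Hypothesis phiD : forall x, 0 < x < 1 -> 0 <= phi x <= D.
Hypothesis phi_up : forall x y, 0 < x -> x <= y -> y < 1 -> phi x <= phi y.
Hypothesis phi_down : forall x y, 0 < x -> x <= y -> y < 1 ->
  (1 - y) * phi y <= (1 - x) * phi x.
Hypothesis phi_r : forall x y, 0 < y -> y <= x -> x < 1 -> x - y <= r ->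
  phi x - phi y <= e.
Hypothesis W0 : W 0 = 0.
Hypothesis W_slope : forall x y, 0 <= x -> x <= y -> y <= 1 -> 0 <= W y - W x <= y - x.
Hypothesis W_small : forall x y, 0 <= x -> x <= y -> y <= 1 ->
  W y - W x <= r * (y * (1 - x)).
Hypothesis W_steep : forall (t : bool) (u v z : R), 0 <= u -> u < v -> v <= 1 -> 0 < z ->
  exists x y, [/\ u < x, x < y, y < v &
    if t then (1 - z) * (y - x) <= W y - W x else W y - W x <= z * (y - x)].

Let g x := x - W x.
(** Lowers the maximal value [D] by [4 * a]: this pays for [a * g x + 2 * a] in [psi] and leaves a
    margin [a] below [D]. *)
Let c := 1 - 4 * a / D.
Let psi x := c * phi (g x) + a * g x + 2 * a.
Let f x := psi x - a / 6 * bump_primitive R x.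

Let D0 : 0 < D. Proof. by have h := D1; lra. Qed.

Let c01 : 0 <= c <= 1.
Proof.
have h := aD; have h0 := a0; have h1 := D0.
have : 0 <= 4 * a / D by rewrite divr_ge0//; lra.
have : 4 * a / D <= 1 by rewrite ler_pdivrMr// mul1r.
by rewrite /c; lra.
Qed.

Let cD : c * D = D - 4 * a.
Proof. by rewrite /c; field; rewrite gt_eqF// D0. Qed.

Let g_slope x y : 0 <= x -> x <= y -> y <= 1 -> 0 <= g y - g x <= y - x.
Proof. by move=> x0 xy y1; have := W_slope _ _ x0 xy y1; rewrite /g; lra. Qed.

Let g_le x : 0 <= x -> x <= 1 -> x - r <= g x <= x.
Proof.
move=> x0 x1; have := W_slope _ _ (lexx 0) x0 x1; have := W_small _ _ (lexx 0) x0 x1.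
have h : r * (x * (1 - 0)) <= r by rewrite subr0 mulr1 ler_piMr// ltW.
by rewrite /g W0; lra.
Qed.

Let g_gt0 x : 0 < x -> x <= 1 -> 0 < g x.
Proof.
move=> x0 x1; have := W_small _ _ (lexx 0) (ltW x0) x1.
have h : r * (x * (1 - 0)) <= 1 / 4 * x by rewrite subr0 mulr1 ler_pM2r.
by rewrite /g W0; lra.
Qed.

Let g01 x : 0 < x < 1 -> 0 < g x < 1.
Proof.
move=> x01; have := g_gt0 x; have := g_le x.
by move=> /(_ ltac:(lra) ltac:(lra)) ? /(_ ltac:(lra) ltac:(lra)); lra.
Qed.

(** If [x <= y ^+ 2], then [y * (1 - x)] is at most twice the length of [[x, y]], so with
    [r <= 1 / 4] the set measured by [W] fills at most half of it. *)
Let g_far x y : 0 <= x -> x <= y -> y <= 1 -> x <= y ^+ 2 -> (y - x) / 2 <= g y - g x.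
Proof.
move=> x0 xy y1 xy2; have := W_small _ _ x0 xy y1.
have h : y * (1 - x) <= 2 * (y - x).
  rewrite -subr_ge0.
  have [y0|y0] := eqVneq y 0; first by rewrite y0; lra.
  have ypos : 0 < y by rewrite lt_def y0; lra.
  rewrite -(pmulr_rge0 _ ypos).
  have h1 : 0 <= 2 * y - y ^+ 2 by rewrite expr2 -mulrBl mulr_ge0//; lra.
  have h2 : x * (2 * y - y ^+ 2) <= y ^+ 2 * (2 * y - y ^+ 2) by rewrite ler_wpM2r.
  have h3 : 0 <= y ^+ 2 * (1 - y) ^+ 2 by rewrite mulr_ge0 ?sqr_ge0.
  lra.
have h' : 0 <= y * (1 - x) by rewrite mulr_ge0//; lra.
have : r * (y * (1 - x)) <= 1 / 4 * (2 * (y - x)) by rewrite ler_pM// ltW.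
by rewrite /g; lra.
Qed.

Let phi_g_up x y : 0 < x -> x <= y -> y < 1 -> phi (g x) <= phi (g y).
Proof.
move=> x0 xy y1; have gx := g01 x; have gy := g01 y.
have := g_slope x y; move=> /(_ ltac:(lra) xy ltac:(lra)) h.
by apply: phi_up; move: (gx ltac:(lra)) (gy ltac:(lra)); lra.
Qed.

(** [(1 - x) * phi (g x)] is the product of [(1 - g x) * phi (g x)] and [(1 - x) / (1 - g x)]. The
    latter quotient is nonincreasing because [g] has slope at most 1 and [g x <= x]. *)
Let phi_g_down x y : 0 < x -> x <= y -> y < 1 ->
  (1 - y) * phi (g y) <= (1 - x) * phi (g x).
Proof.
move=> x0 xy y1; have gx := g01 x ltac:(lra); have gy := g01 y ltac:(lra).
have gxy := g_slope x y ltac:(lra) xy ltac:(lra).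
have gxx := g_le x ltac:(lra) ltac:(lra).
have h1 : (1 - g y) * phi (g y) <= (1 - g x) * phi (g x) by apply: phi_down; lra.
have /andP[p0 _] := phiD _ gx.
have h2 : (1 - y) * (1 - g x) <= (1 - x) * (1 - g y).
  have : 0 <= (y - x) * (x - g x) by rewrite mulr_ge0//; lra.
  have : (1 - x) * (g y - g x) <= (1 - x) * (y - x) by rewrite ler_wpM2l//; lra.
  lra.
have y1' : 0 < 1 - g y by lra.
rewrite -(ler_pM2l y1').
have h3 : (1 - y) * ((1 - g y) * phi (g y)) <= (1 - y) * ((1 - g x) * phi (g x)).
  by rewrite ler_wpM2l//; lra.
have h4 : (1 - y) * (1 - g x) * phi (g x) <= (1 - x) * (1 - g y) * phi (g x).
  by rewrite ler_wpM2r.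
lra.
Qed.

Let psi_up x y : 0 < x -> x <= y -> y < 1 -> a * (g y - g x) <= psi y - psi x.
Proof.
move=> x0 xy y1; have h := phi_g_up _ _ x0 xy y1.
have /andP[cc _] := c01.
have : c * phi (g x) <= c * phi (g y) by rewrite ler_wpM2l.
by rewrite /psi; lra.
Qed.

(** Ensures that [psi] is nearly constant wherever [g] is, so that the bump term can make [f]
    decrease there. *)
Let psi_lip x y : 0 < x -> x <= y -> y < 1 ->
  psi y - psi x <= (D / (1 - y) + a) * (g y - g x).
Proof.
move=> x0 xy y1; have gx := g01 x ltac:(lra); have gy := g01 y ltac:(lra).
have gxy := g_slope x y ltac:(lra) xy ltac:(lra).
have gyy := g_le y ltac:(lra) ltac:(lra).
have h1 : (1 - g y) * phi (g y) <= (1 - g x) * phi (g x) by apply: phi_down; lra.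
have h0 := phi_g_up _ _ x0 xy y1.
have /andP[p0 pD] := phiD _ gx.
have y1' : 0 < 1 - y by lra.
have h2 : (1 - y) * (phi (g y) - phi (g x)) <= (g y - g x) * D.
  have : (1 - y) * (phi (g y) - phi (g x)) <= (1 - g y) * (phi (g y) - phi (g x)).
    by rewrite ler_wpM2r//; lra.
  have : (g y - g x) * phi (g x) <= (g y - g x) * D by rewrite ler_wpM2l//; lra.
  lra.
have h3 : phi (g y) - phi (g x) <= D / (1 - y) * (g y - g x).
  by rewrite -(ler_pM2l y1'); apply: (le_trans h2); rewrite le_eqVlt; apply/orP; left;
    apply/eqP; field; rewrite gt_eqF.
have /andP[cc c1] := c01.
have : c * (phi (g y) - phi (g x)) <= 1 * (phi (g y) - phi (g x)).
  by rewrite ler_wpM2r//; lra.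
by rewrite /psi; lra.
Qed.

Let psi_itv x : 0 < x < 1 -> 2 * a <= psi x <= D - a.
Proof.
move=> x01; have gx := g01 x x01; have /andP[p0 pD] := phiD _ gx; have h0 := a0.
have /andP[cc c1] := c01.
have : c * phi (g x) <= c * D by rewrite ler_wpM2l.
have : 0 <= c * phi (g x) by rewrite mulr_ge0.
have : a * g x <= a * 1 by rewrite ler_pM2l//; lra.
have : 0 <= a * g x by rewrite mulr_ge0//; lra.
by rewrite cD /psi; lra.
Qed.

(** For the lower bound one [a] of the constant [2 * a] joins [a * g x], whose product with [1 - x]
    stays nonincreasing, and the other gives the slope [a]. The margins [a] on both sides absorb the
    bump term in [f_down]. *)
Let psi_down x y : 0 < x -> x <= y -> y < 1 ->
  a * (y - x) <= (1 - x) * psi x - (1 - y) * psi y <= (D - a) * (y - x).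
Proof.
move=> x0 xy y1; have gx := g01 x ltac:(lra); have gy := g01 y ltac:(lra).
have gxy := g_slope x y ltac:(lra) xy ltac:(lra).
have /andP[cc c1] := c01.
have h1 := phi_g_down _ _ x0 xy y1; have h0 := a0.
apply/andP; split.
  have : c * ((1 - y) * phi (g y)) <= c * ((1 - x) * phi (g x)) by rewrite ler_wpM2l.
  have : a * ((1 - y) * (g y + 1)) <= a * ((1 - x) * (g x + 1)).
    rewrite ler_pM2l//.
    have : (1 - y) * (g y - g x) <= (1 - y) * (y - x) by rewrite ler_wpM2l//; lra.
    have : 0 <= (y - x) * (g x + y) by rewrite mulr_ge0//; lra.
    lra.
  by rewrite /psi; lra.
have h2 := psi_up _ _ x0 xy y1.
have h3 := psi_itv x ltac:(lra).
have h4 : 0 <= a * (g y - g x) by rewrite mulr_ge0//; lra.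
have : 0 <= (1 - y) * (psi y - psi x) by rewrite mulr_ge0//; lra.
have : (y - x) * psi x <= (y - x) * (D - a) by rewrite ler_wpM2l//; lra.
lra.
Qed.

Let f_ge0 x : 0 < x < 1 -> 0 <= f x.
Proof.
move=> x01; have h1 := psi_itv x x01; have h0 := a0.
have := bump_primitive_itv R x ltac:(lra) => /andP[_ h].
have : a / 6 * bump_primitive R x <= a / 6 * (1 / 6) by rewrite ler_wpM2l//; lra.
by rewrite /f; lra.
Qed.

Let f_down x y : 0 < x -> x <= y -> y <= 1 ->
  (1 - y) * f y <= (1 - x) * f x <= (1 - y) * f y + D * (y - x).
Proof.
(* The hypotheses on [phi] stop short of 1. At [y = 1] the value [f 1] is multiplied by 0, and for
   [x < 1] the claim becomes [0 <= f x <= D]. *)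
move=> x0 xy; rewrite le_eqVlt => /orP[/eqP y1|y1]; have h0 := a0.
  rewrite y1 subrr !mul0r add0r; rewrite y1 in xy.
  move: (xy); rewrite le_eqVlt => /orP[/eqP ->|x1]; first by rewrite subrr !mul0r mulr0 lexx.
  have fx := f_ge0 x ltac:(lra).
  rewrite mulr_ge0//=; last lra.
  rewrite mulrC ler_wpM2r//; first lra.
  have := psi_itv x ltac:(lra).
  have := bump_primitive_itv R x ltac:(lra) => /andP[h _].
  have : 0 <= a / 6 * bump_primitive R x by rewrite mulr_ge0//; lra.
  by rewrite /f; lra.
have h1 := psi_down _ _ x0 xy y1.
have := bump_primitive_itv R x ltac:(lra) => /andP[k1 k2].
have yx : 0 <= y - x by rewrite subr_ge0.
have k3 := bump_primitive_lip _ x y (ltW x0) xy (ltW y1).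
have k4 := bump_primitive_homo _ x y (ltW x0) xy (ltW y1).
have k5 : 0 <= (1 - y) * (bump_primitive R y - bump_primitive R x).
  by rewrite mulr_ge0 ?subr_ge0// ltW.
have k6 : 0 <= (y - x) * bump_primitive R x by rewrite mulr_ge0//; lra.
have k7 : (y - x) * bump_primitive R x <= (y - x) * (1 / 6) by rewrite ler_wpM2l//; lra.
have k8 : (1 - y) * (bump_primitive R y - bump_primitive R x) <= 1 * (y - x).
  by rewrite ler_pM ?subr_ge0// ?(ltW y1)// gerBl ltW// (lt_le_trans x0).
have l1 : a * ((y - x) * bump_primitive R x) <= a * ((y - x) * (1 / 6)).
  by rewrite ler_pM2l.
have l2 : 0 <= a * ((1 - y) * (bump_primitive R y - bump_primitive R x)).
  by rewrite mulr_ge0// ltW.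
have l3 : a * ((1 - y) * (bump_primitive R y - bump_primitive R x)) <= a * (1 * (y - x)).
  by rewrite ler_pM2l.
have l4 : 0 <= a * ((y - x) * bump_primitive R x) by rewrite mulr_ge0// ltW.
have l5 : 0 <= a * (y - x) by rewrite mulr_ge0// ltW.
by rewrite /f; lra.
Qed.

(** Let [s] be the square root of [x = theta * t]. From [s] on, [psi] gains [a * (y - x) / 2] by
    [g_far] and the bump term takes back at most a third of this, leaving at least
    [a / 3 * (s - x)]. Up to [s], only the bump term can cause a loss, and it costs at most
    [a / 3 * (s - x) * (y - x)]. *)
Let f_window t theta : 0 < t < 1 -> 0 < theta < 1 ->
  (1 - theta * t) * f (theta * t) <= (1 - t) * f t + t * ((1 - theta) * f theta).
Proof.
move=> t01 th01; set x := theta * t.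
have xpos : 0 < x by rewrite /x mulr_gt0//; lra.
have x1 : x < 1 by rewrite /x mulr_ilt1//; lra.
pose s := Num.sqrt x.
have sE : s ^+ 2 = x by rewrite sqr_sqrtr// ltW.
have spos : 0 < s by rewrite sqrtr_gt0.
have s1 : s < 1 by rewrite -(ltr_pXn2r (n := 2)) ?nnegrE ?expr1n ?sE// ltW.
have xs : x < s by rewrite -sE expr2 gtr_pMr.
have h0 := a0.
apply: (@window_inequality _ f x t theta (a / 3 * (s - x)) s) => //.
- exact: ltW.
- by rewrite mulr_ge0//; lra.
- move=> y /andP[sy y1].
  have h1 := psi_up x y xpos ltac:(lra) y1.
  have xy2 : x <= y ^+ 2 by rewrite -sE ler_pXn2r// nnegrE; lra.
  have h2 := g_far x y (ltW xpos) ltac:(lra) (ltW y1) xy2.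
  have h3 := bump_primitive_lip R x y (ltW xpos) (ltW (lt_le_trans xs sy)) (ltW y1).
  have h5 : a * ((y - x) / 2) <= a * (g y - g x) by rewrite ler_pM2l.
  have h6 : a / 6 * (bump_primitive R y - bump_primitive R x) <= a / 6 * (y - x).
    by rewrite ler_pM2l; lra.
  have h7 : a * (s - x) <= a * (y - x) by rewrite ler_pM2l//; lra.
  by rewrite /f; lra.
- move=> y /andP[xy y1].
  have h1 := psi_up x y xpos ltac:(lra) y1.
  have h2 := g_slope x y (ltW xpos) (ltW xy) (ltW y1).
  have h2' : 0 <= a * (g y - g x) by rewrite mulr_ge0//; lra.
  have [ys|sy] := leP y s.
    have h3 := bump_primitive_le R x y (ltW xpos) (ltW xy) (ltW y1).
    (* As [x = s ^+ 2], the slack in [s * (1 - x) <= 2 * (s - x)] is [s * (1 - s) ^+ 2]. *)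
    have h4 : y * (1 - x) <= 2 * (s - x).
      have h5 : y * (1 - x) <= s * (1 - x) by rewrite ler_wpM2r//; lra.
      apply: (le_trans h5); rewrite -sE.
      have : 0 <= s * (1 - s) ^+ 2 by rewrite mulr_ge0 ?sqr_ge0 ?ltW.
      by rewrite -subr_ge0 => h6; rewrite -subr_ge0; nra.
    have h5 : a / 6 * (bump_primitive R y - bump_primitive R x) <=
      a / 6 * ((y - x) * (2 * (s - x))).
      rewrite ler_pM2l; last lra.
      by apply: (le_trans h3); rewrite ler_wpM2l//; lra.
    by rewrite /f; lra.
  have xy2 : x <= y ^+ 2 by rewrite -sE ler_pXn2r// ?nnegrE; lra.
  have h3 := bump_primitive_lip R x y (ltW xpos) (ltW (lt_le_trans xs (ltW sy))) (ltW y1).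
  have h5 := g_far x y (ltW xpos) ltac:(lra) (ltW y1) xy2.
  have h6 : a * ((y - x) / 2) <= a * (g y - g x) by rewrite ler_pM2l.
  have h7 : a / 6 * (bump_primitive R y - bump_primitive R x) <= a / 6 * (y - x).
    by rewrite ler_pM2l; lra.
  have yx : 0 <= y - x by rewrite subr_ge0 ltW.
  have h8 : 0 <= a / 3 * (s - x) * (y - x).
    by rewrite !mulr_ge0 ?invr_ge0 ?subr_ge0// ltW.
  have h9 : 0 <= a * (y - x) by rewrite mulr_ge0// ltW.
  by rewrite /f; lra.
Qed.

Let f_close x : 0 < x < 1 -> `|f x - phi x| <= e + 8 * a.
Proof.
move=> x01; have gx := g01 x x01; have gxx := g_le x ltac:(lra) ltac:(lra).
have h0 := a0.
have h1 : phi x - phi (g x) <= e by apply: phi_r; lra.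
have h2 : phi (g x) <= phi x by apply: phi_up; lra.
have /andP[p0 pD] := phiD _ gx.
have h3 : (1 - c) * phi (g x) <= (1 - c) * D by rewrite ler_wpM2l//; have := c01; lra.
have h3' : 0 <= (1 - c) * phi (g x) by rewrite mulr_ge0//; have := c01; lra.
have h4 : (1 - c) * D = 4 * a by rewrite mulrBl mul1r cD; ring.
have h5 : a * g x <= a * 1 by rewrite ler_pM2l//; lra.
have h6 : 0 <= a * g x by rewrite mulr_ge0//; lra.
have := bump_primitive_itv R x ltac:(lra) => /andP[k1 k2].
have h7 : a / 6 * bump_primitive R x <= a / 6 * (1 / 6) by rewrite ler_wpM2l//; lra.
have h8 : 0 <= a / 6 * bump_primitive R x by rewrite mulr_ge0//; lra.
by rewrite ler_norml /f /psi; lra.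
Qed.

Let f_nowhere_monotone (t : bool) (u v : R) : 0 <= u -> u < v -> v <= 1 ->
  exists x y, [/\ u < x, x < y, y < v & if t then f x < f y else f y < f x].
Proof.
move=> u0 uv v1; have h0 := a0; case: t.
  (* Where [W] grows at most at rate [1 / 4], [psi] gains [3 / 4 * a] per unit length and the bump
     term costs only [a / 6]. *)
  have [x [y [ux xy yv h]]] := W_steep false u v (1 / 4) u0 uv v1 ltac:(lra).
  exists x, y; split=> //.
  have h1 := psi_up x y ltac:(lra) (ltW xy) ltac:(lra).
  have h2 := bump_primitive_lip R x y ltac:(lra) (ltW xy) ltac:(lra).
  have h4 : a / 6 * (bump_primitive R y - bump_primitive R x) <= a / 6 * (y - x).
    by rewrite ler_pM2l; lra.
  have h5 : a * (3 / 4 * (y - x)) <= a * (g y - g x) by rewrite ler_pM2l// /g; lra.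
  have h6 : 0 < a * (y - x) by rewrite mulr_gt0//; lra.
  by rewrite /f; lra.
(* On the middle third both the Lipschitz constant [L] of [psi] in terms of [g] and the lower bound
   [m] for the slope of the bump are uniform. *)
pose u' := (2 * u + v) / 3; pose v' := (u + 2 * v) / 3.
have u'v' : u' < v' by rewrite /u' /v'; lra.
have u'0 : 0 < u' by rewrite /u'; lra.
have v'1 : v' < 1 by rewrite /v'; lra.
pose m := u' * (1 - v').
have m0 : 0 < m by rewrite /m mulr_gt0//; lra.
pose L := D / (1 - v') + a.
have L0 : 0 < L by rewrite /L addr_gt0// divr_gt0//; lra.
(* With this [z], [psi] rises by at most [a * m * (y - x) / 18], while the bump term falls by at
   least twice as much. *)
pose z := a * m / 18 / L.
have z0 : 0 < z by rewrite /z !divr_gt0// mulr_gt0.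
have [x [y [ux xy yv h]]] := W_steep true u' v' z (ltW u'0) u'v' (ltW v'1) z0.
exists x, y; split=> //.
- by move: ux; rewrite /u'; lra.
- by move: yv; rewrite /v'; lra.
have h1 := psi_lip x y ltac:(lra) (ltW xy) ltac:(lra).
have h2 := bump_primitive_ge R x y ltac:(lra) (ltW xy) ltac:(lra).
have gxy := g_slope x y ltac:(lra) (ltW xy) ltac:(lra).
have h3 : (D / (1 - y) + a) * (g y - g x) <= L * (z * (y - x)).
  rewrite ler_pM//.
  - by rewrite addr_ge0 ?divr_ge0 ?(ltW D0)// ?(ltW h0)//; lra.
  - by lra.
  - by rewrite /L lerD2r ler_pM2l ?D0// lef_pV2 ?posrE; lra.
  - by rewrite /g; lra.
have h4 : L * (z * (y - x)) = a * (m * (y - x)) / 18 by rewrite /z; field; rewrite gt_eqF.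
have xv := ltW (lt_trans xy yv); have uy := ltW (lt_trans ux xy).
have h5 : m <= x * (1 - x).
  exact: bump_slope_ge (ltW u'0) (ltW ux) xv (ltW v'1).
have h6 : m <= y * (1 - y).
  exact: bump_slope_ge (ltW u'0) uy (ltW yv) (ltW v'1).
have yx : 0 < y - x by rewrite subr_gt0.
have h7 : (y - x) * (2 * m / 3) <= (y - x) * ((x * (1 - x) + y * (1 - y)) / 3).
  by rewrite ler_pM2l//; lra.
have h8 : a / 6 * ((y - x) * (2 * m / 3)) <=
    a / 6 * (bump_primitive R y - bump_primitive R x).
  by rewrite ler_pM2l; [apply: le_trans h2 | lra].
have h9 : 0 < a * (m * (y - x)) by apply: mulr_gt0 => //; apply: mulr_gt0.
by rewrite /f; lra.
Qed.

Lemma profile_aux : exists f : R -> R, [/\ forall x, 0 < x < 1 -> 0 <= f x,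
  forall x y, 0 < x -> x <= y -> y <= 1 ->
    (1 - y) * f y <= (1 - x) * f x <= (1 - y) * f y + D * (y - x),
  forall t theta, 0 < t < 1 -> 0 < theta < 1 ->
    (1 - theta * t) * f (theta * t) <= (1 - t) * f t + t * ((1 - theta) * f theta),
  forall x, 0 < x < 1 -> `|f x - phi x| <= e + 8 * a &
  forall (t : bool) (u v : R), 0 <= u -> u < v -> v <= 1 ->
    exists x y, [/\ u < x, x < y, y < v & if t then f x < f y else f y < f x]].
Proof. by exists f. Qed.

End profile.

Lemma exists_profile (R : realType) (D e : R) (phi : R -> R) :
  1 <= D -> 0 < e ->
  (forall x, 0 < x < 1 -> 0 <= phi x <= D) ->
  (forall x y, 0 < x -> x <= y -> y < 1 -> phi x <= phi y) ->
  (forall x y, 0 < x -> x <= y -> y < 1 -> (1 - y) * phi y <= (1 - x) * phi x) ->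
  exists f : R -> R, [/\ forall x, 0 < x < 1 -> 0 <= f x,
  forall x y, 0 < x -> x <= y -> y <= 1 ->
    (1 - y) * f y <= (1 - x) * f x <= (1 - y) * f y + D * (y - x),
  forall t theta, 0 < t < 1 -> 0 < theta < 1 ->
    (1 - theta * t) * f (theta * t) <= (1 - t) * f t + t * ((1 - theta) * f theta),
  forall x, 0 < x < 1 -> `|f x - phi x| <= e &
  forall (t : bool) (u v : R), 0 <= u -> u < v -> v <= 1 ->
    exists x y, [/\ u < x, x < y, y < v & if t then f x < f y else f y < f x]].
Proof.
move=> D1 e0 phiD phi_up phi_down; have D0 : 0 < D by lra.
have e2 : 0 < e / 2 by lra.
have [r /andP[r0 r1] hr] := @left_uniformly_close _ _ _ _ D0 e2 phiD phi_up phi_down.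
have [W [W0 W1 W2 W3]] := @exists_oscillating_measure R r r0.
(* So that [e / 2 + 8 * a <= e] and [4 * a <= 1 <= D]. *)
pose a := Num.min (e / 16) (1 / 4).
have a0 : 0 < a by rewrite /a lt_min; apply/andP; split; lra.
have a1 : a <= e / 16 by rewrite /a ge_min lexx.
have a2 : a <= 1 / 4 by rewrite /a ge_min lexx orbT.
have aD : 4 * a <= D by lra.
have [f [f1 f2 f3 f4 f5]] := @profile_aux _ _ _ _ _ _ _
  D1 a0 aD r0 r1 phiD phi_up phi_down hr W0 W1 W2 W3.
exists f; split=> // x x01; apply: (le_trans (f4 x x01)); lra.
Qed.

(** * From the profile to numbers of free digits *)

(** Each term is the square of the one before, so for fixed [rho > 0] and large [q] the window from
    [rho * q] to [q] meets at most two consecutive blocks. *)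
Definition tower (j : nat) : nat := (2 ^ 2 ^ j)%N.

Lemma tower_gt0 j : (0 < tower j)%N.
Proof. by rewrite expn_gt0. Qed.

Lemma towerS j : tower j.+1 = (tower j * tower j)%N.
Proof. by rewrite /tower expnS mul2n -addnn expnD. Qed.

Lemma tower_gt j : (j < tower j)%N.
Proof. by apply: (ltn_trans (ltn_expl j (ltnSn 1))); exact: ltn_expl. Qed.

Lemma leq_tower i j : (i <= j)%N -> (tower i <= tower j)%N.
Proof. by move=> ij; rewrite /tower !leq_exp2l. Qed.

Definition tower_zone (m : nat) : nat := trunc_log 2 (trunc_log 2 m).

Lemma tower_zoneP j m : (tower j <= m)%N -> (m < tower j.+1)%N -> tower_zone m = j.
Proof.
move=> jm mj; apply: trunc_log_eq => //; apply/andP; split.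
  by apply: trunc_log_max.
rewrite -(@ltn_exp2l 2)//; apply: leq_ltn_trans mj.
by apply: trunc_logP => //; exact: leq_trans (tower_gt0 j) jm.
Qed.

Lemma tower_zone_bounds m : (1 < m)%N ->
  (tower (tower_zone m) <= m)%N && (m < tower (tower_zone m).+1)%N.
Proof.
move=> m1; have l0 : (0 < trunc_log 2 m)%N by rewrite trunc_log_gt0.
have /andP[h1 h2] := trunc_log_bounds (ltnSn 1) l0.
have /andP[h3 h4] := trunc_log_bounds (ltnSn 1) (ltnW m1).
apply/andP; split; first by apply: leq_trans h3; rewrite leq_exp2l.
by apply: (leq_trans h4); rewrite leq_exp2l.
Qed.

Section digit_counts.
Variables (R : realType) (d : nat) (k : R -> R).
Hypothesis k_down : forall x y, 0 < x -> x <= y -> y <= 1 ->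
  k y <= k x <= k y + d%:R * (y - x).
Hypothesis k1 : k 1 = 0.
Hypothesis k_window : forall t theta, 0 < t < 1 -> 0 < theta < 1 ->
  k (theta * t) <= k t + t * k theta.

(** The right end of block [j], where the rescaled variable is 1 and [k] vanishes. *)
Let T j : R := (tower j.+1)%:R.

Let inc (i : nat) : R := let j := tower_zone i in
  if odd j then T j * (k (i%:R / T j) - k (i.+1%:R / T j)) else 0.

Let G (m : nat) : R := \sum_(0 <= i < m) inc i.

Let T_gt0 j : 0 < T j.
Proof. by rewrite /T ltr0n tower_gt0. Qed.

Let k_ge0 x : 0 < x -> x <= 1 -> 0 <= k x.
Proof. by move=> x0 x1; rewrite -k1; have /andP[] := k_down _ _ x0 x1 (lexx 1). Qed.

Let inc_itv i : 0 <= inc i <= d%:R.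
Proof.
rewrite /inc; case: ifPn => oj; last by rewrite lexx ler0n.
(* The places 0 and 1 precede block 0 but have [tower_zone] 0, which is even. *)
have i1 : (1 < i)%N.
  by rewrite ltnNge; apply/negP; case: i oj => [|[|i]] //;
    rewrite /tower_zone ?trunc_log0 ?trunc_log1 ?trunc_log0.
have /andP[h1 h2] := tower_zone_bounds _ i1.
have Tj := T_gt0 (tower_zone i); move: Tj h2; rewrite /T.
move: (tower (tower_zone i).+1) => t t0 it.
have it' : (i.+1%:R : R) <= t%:R by rewrite ler_nat.
have /andP[h3 h4] : k (i.+1%:R / t%:R) <= k (i%:R / t%:R) <=
    k (i.+1%:R / t%:R) + d%:R * (i.+1%:R / t%:R - i%:R / t%:R).
  apply: k_down; first by rewrite divr_gt0// ltr0n (ltn_trans _ i1).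
    by rewrite ler_pM2r ?invr_gt0// ler_nat.
  by rewrite ler_pdivrMr// mul1r.
have t0' : 0 < t%:R :> R by [].
apply/andP; split; first by rewrite mulr_ge0 ?subr_ge0// ltW.
rewrite -ler_pdivlMl//.
have -> : t%:R^-1 * d%:R = d%:R * (i.+1%:R / t%:R - i%:R / t%:R) :> R.
  by rewrite -mulrBl -natrB// subSnn mul1r mulrC.
by rewrite lerBlDl.
Qed.

Let G_rec m : G m.+1 = G m + inc m.
Proof. by rewrite /G big_nat_recr. Qed.

Let G_diff p q : (p <= q)%N -> 0 <= G q - G p <= d%:R * (q - p)%:R.
Proof.
move=> /subnK <-; move: (q - p)%N => n; rewrite addnK.
elim: n => [|n IH]; first by rewrite add0n subrr mulr0 lexx.
rewrite addSn G_rec.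
by have := inc_itv (n + p); rewrite -[n.+1%:R]natr1 mulrDr mulr1; move: IH; lra.
Qed.

Let G_even j p q : ~~ odd j -> (tower j <= p)%N -> (p <= q)%N -> (q <= tower j.+1)%N ->
  G q = G p.
Proof.
move=> oj jp /subnK <-; move: (q - p)%N => n.
elim: n => [|n IH] nj //.
rewrite addSn G_rec IH; last exact: ltnW.
rewrite /inc (@tower_zoneP j) ?(negbTE oj) ?addr0//.
exact: leq_trans (leq_addl _ _).
Qed.

Let G_odd j p q : odd j -> (tower j <= p)%N -> (p <= q)%N -> (q <= tower j.+1)%N ->
  G q - G p = T j * (k (p%:R / T j) - k (q%:R / T j)).
Proof.
move=> oj jp /subnK <-; move: (q - p)%N => n.
elim: n => [|n IH] nj; first by rewrite add0n !subrr mulr0.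
rewrite addSn G_rec addrAC IH; last exact: ltnW.
rewrite /inc (@tower_zoneP j) ?oj//; first by ring.
exact: leq_trans (leq_addl _ _).
Qed.

(** This is [k_window] for the ratios [p / q] and [q / t], multiplied by [t]. If [q = t], equality
    holds by [k1]. *)
Let window_scaled (p q t : R) : 0 < p -> p < q -> q <= t ->
  t * (k (p / t) - k (q / t)) <= q * k (p / q).
Proof.
move=> p0 pq; have q0 : 0 < q by exact: lt_trans pq.
rewrite le_eqVlt => /orP[/eqP <-|qt].
  by rewrite divff ?gt_eqF// k1 subr0.
have t0 : 0 < t by exact: lt_trans qt.
have := k_window (q / t) (p / q).
have -> : p / q * (q / t) = p / t by field; rewrite !gt_eqF.
rewrite !divr_gt0// !ltr_pdivrMr// !mul1r pq qt => /(_ isT isT) h.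
have : t * k (p / t) <= t * (k (q / t) + q / t * k (p / q)) by rewrite ler_pM2l.
rewrite mulrDr mulrA (mulrCA t) divff ?gt_eqF// mulr1; lra.
Qed.

(** Inside one block this is [window_scaled] or trivial. A window straddling two blocks grows only
    in the odd one: if that is the later block, moving the left end back to [p] increases the bound;
    if it is the earlier one, moving the right end forward to [q] does. *)
Let G_upper j p q : (0 < p)%N -> (p < q)%N -> (0 < j)%N ->
  (tower j.-1 <= p)%N -> (tower j < q)%N -> (q <= tower j.+1)%N ->
  G q - G p <= q%:R * k (p%:R / q%:R).
Proof.
case: j => // j p0 pq _ /= jp jq qj.
have p0' : 0 < p%:R :> R by rewrite ltr0n.
have pq' : p%:R < q%:R :> R by rewrite ltr_nat.
have q0' : 0 < q%:R :> R by exact: lt_trans pq'.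
have Tj := T_gt0 j.+1; have Tj' := T_gt0 j.
have qT : q%:R <= T j.+1 by rewrite ler_nat.
have kpq0 : 0 <= k (p%:R / q%:R).
  by apply: k_ge0; rewrite ?divr_gt0// ler_pdivrMr// mul1r ltW.
have [jp'|pj'] := leqP (tower j.+1) p.
  have [oj|ej] := boolP (odd j.+1).
    by rewrite (G_odd _ _ _ oj jp' (ltnW pq) qj); exact: window_scaled.
  by rewrite (G_even _ _ _ ej jp' (ltnW pq) qj) subrr mulr_ge0// ltW.
have -> : G q - G p = (G q - G (tower j.+1)) + (G (tower j.+1) - G p) by ring.
have [oj|ej] := boolP (odd j.+1).
  rewrite (G_odd _ _ _ oj (leqnn _) (ltnW jq) qj).
  rewrite (G_even _ _ _ oj jp (ltnW pj') (leqnn _)) subrr addr0.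
  apply: le_trans (window_scaled _ _ _ p0' pq' qT).
  rewrite ler_pM2l// lerB//.
  have /andP[] := k_down (p%:R / T j.+1) ((tower j.+1)%:R / T j.+1)
    ltac:(by rewrite divr_gt0) ltac:(by rewrite ler_pM2r ?invr_gt0// ler_nat ltnW)
    ltac:(by rewrite ler_pdivrMr// mul1r ler_nat leq_tower).
  by [].
rewrite (G_even _ _ _ ej (leqnn _) (ltnW jq) qj) subrr add0r.
have oj : odd j by move: ej; rewrite /= negbK.
rewrite (G_odd _ _ _ oj jp (ltnW pj') (leqnn _)) -/(T j) divff ?gt_eqF// k1 subr0.
have Tq : T j <= q%:R by rewrite ler_nat ltnW.
have /andP[h _] := k_down (p%:R / q%:R) (p%:R / T j) ltac:(by rewrite divr_gt0)
  ltac:(by rewrite ler_pM2l// lef_pV2) ltac:(by rewrite ler_pdivrMr// mul1r ler_nat ltnW).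
have h0 : 0 <= k (p%:R / T j).
  by apply: k_ge0; rewrite ?divr_gt0// ler_pdivrMr// mul1r ler_nat ltnW.
by rewrite ler_pM// ltW.
Qed.

(** Truncating the partial sums and not the increments keeps every window sum within 1 of
    [G q - G p]. *)
Let a m := (Num.truncn (G m.+1) - Num.truncn (G m))%N.

Let G_homo p q : (p <= q)%N -> G p <= G q.
Proof. by move=> /G_diff /andP[h _]; rewrite -subr_ge0. Qed.

Let G_ge0 p : 0 <= G p.
Proof. by apply: sumr_ge0 => i _; have /andP[] := inc_itv i. Qed.

Let sum_a p q : (p <= q)%N ->
  G q - G p - 1 <= (\sum_(p <= m < q) a m)%:R <= G q - G p + 1.
Proof.
move=> pq; rewrite telescope_sumn; last by move=> x y xy; exact: le_truncn (G_homo _ _ xy).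
rewrite natrB; last exact: le_truncn (G_homo _ _ pq).
have /andP[h1 h2] := truncn_itv (G_ge0 p); have /andP[h3 h4] := truncn_itv (G_ge0 q).
rewrite -natr1 in h2; rewrite -natr1 in h4.
lra.
Qed.

Let exists_tower_ge (rho : R) : 0 < rho ->
  exists J, forall j, (J <= j)%N -> 1 <= rho * (tower j)%:R.
Proof.
move=> rho0; exists (Num.bound rho^-1) => j Jj.
have h : rho^-1 < (Num.bound rho^-1)%:R by rewrite archi_boundP// invr_ge0 ltW.
rewrite -ler_pdivrMl// mulr1; apply: (le_trans (ltW h)); rewrite ler_nat.
exact: leq_trans Jj (ltnW (tower_gt j)).
Qed.

Lemma exists_digit_counts : exists a : nat -> nat,
  [/\ forall m, (a m <= d)%N,
  forall rho : R, 0 < rho -> exists C : R, forall p q, (0 < p)%N -> (p < q)%N ->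
    rho * q%:R <= p%:R -> (\sum_(p <= m < q) a m)%:R <= q%:R * k (p%:R / q%:R) + C &
  forall rho : R, 0 < rho -> forall N, exists2 q, (N <= q)%N &
    forall p, (0 < p)%N -> (p <= q)%N -> rho * q%:R <= p%:R ->
    q%:R * k (p%:R / q%:R) - 1 <= (\sum_(p <= m < q) a m)%:R].
Proof.
exists a; split.
- move=> m; rewrite /a leq_subLR.
  rewrite truncn_le_nat -natr1 natrD.
  have := truncnS_gt (G m); rewrite -natr1.
  by have := G_diff _ _ (leqnSn m); rewrite subSnn mulr1; lra.
- move=> rho rho0; have [J hJ] := exists_tower_ge _ rho0.
  (* Windows ending by [tower J.+2] are covered by the trivial bound [d] per place. Later ones reach
     back at most one block, since [tower i <= rho * tower i.+1] for [i >= J]. The 1 is the rounding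
     error of [sum_a]. *)
  exists (d%:R * (tower J.+2)%:R + 1) => p q p0 pq rpq.
  have /andP[_ h] := sum_a _ _ (ltnW pq); apply: (le_trans h).
  have k0 : 0 <= q%:R * k (p%:R / q%:R).
    have q0' : 0 < q%:R :> R by rewrite ltr0n (ltn_trans p0).
    rewrite mulr_ge0//; apply: k_ge0; first by rewrite divr_gt0// ltr0n.
    by rewrite ler_pdivrMr// mul1r ler_nat ltnW.
  suff : G q - G p <= q%:R * k (p%:R / q%:R) \/ G q - G p <= d%:R * (tower J.+2)%:R.
    have : 0 <= d%:R * (tower J.+2)%:R :> R by rewrite mulr_ge0.
    by move=> ? []; lra.
  have [qJ|Jq] := leqP q (tower J.+2).
    right; have /andP[_ h'] := G_diff _ _ (ltnW pq); apply: (le_trans h').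
    by rewrite ler_wpM2l// ler_nat (leq_trans (leq_subr _ _)).
  left.
  (* The block of [q.-1] is used because [q] may itself be the right end of a block. *)
  have q1 : (1 < q.-1)%N.
    have : (2 < tower J.+2)%N.
      by apply: (@leq_trans (tower 1)) => //; exact: leq_tower.
    by lia.
  have /andP[z1 z2] := tower_zone_bounds _ q1.
  move: z1 z2; set j := tower_zone _ => z1 z2.
  have Jj : (J.+1 < j)%N.
    rewrite ltnNge; apply/negP => jJ.
    by have := leq_tower _ _ (jJ : (j.+1 <= J.+2)%N); lia.
  apply: (G_upper j) => //; [lia| |lia|lia].
  case: (j) Jj z1 => // i; rewrite ltnS /= => Ji z1.
  have := hJ i (ltnW Ji); rewrite -(ler_nat R) => h1.
  apply: le_trans rpq.
  apply: (@le_trans _ _ (rho * (tower i.+1)%:R)); last by rewrite ler_pM2l// ler_nat; lia.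
  rewrite towerS natrM mulrA.
  by rewrite ler_peMl.
- move=> rho rho0 N; have [J hJ] := exists_tower_ge _ rho0.
  (* An odd block; at its right end [q] the growth of [G] from [p] is exactly [q * k (p / q)]. *)
  pose j := (J + N).*2.+1.
  exists (tower j.+1).
    by apply: leq_trans (ltnW (tower_gt _)); rewrite /j; lia.
  move=> p p0 pq rpq.
  have jp : (tower j <= p)%N.
    rewrite -(ler_nat R); apply: le_trans rpq; rewrite towerS natrM mulrA ler_peMl//.
    by apply: hJ; rewrite /j; lia.
  have /andP[h _] := sum_a _ _ pq; apply: le_trans h.
  rewrite (G_odd j)//; last by rewrite /j /= odd_double.
  by rewrite -/(T j) divff ?gt_eqF// k1 subr0 lerB.
Qed.

End digit_counts.

(** * The homogeneous digit set and its covering numbers *)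

Section digit_words.
Variables (d : nat) (a : nat -> nat).
Local Open Scope nat_scope.

Definition free_digits (m : nat) : {set 'I_d} := [set i : 'I_d | i < a m].

(* The integer vectors whose binary digits number [p], ..., [p + n - 1] (leading
   digit first) vanish in coordinate [i] at the places [m] with [a m <= i]. *)
Fixpoint digit_words (p n : nat) : seq {ffun 'I_d -> nat} :=
  if n is n'.+1 then
    [seq [ffun i => 2 * (w : {ffun 'I_d -> nat}) i + (i \in (e : {set 'I_d}))]
    | w <- digit_words p n', e <- enum (powerset (free_digits (p + n')))]
  else [:: [ffun=> 0]].

Lemma digit_wordsS p n w : reflect
  (exists2 w', w' \in digit_words p n & exists2 e : {set 'I_d},
    e \subset free_digits (p + n) & w = [ffun i => 2 * w' i + (i \in e)])
  (w \in digit_words p n.+1).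
Proof.
apply: (iffP allpairsP) => /= [[[w' e] /= [h1 h2 ->]]|[w' h1 [e h2 ->]]].
  by exists w' => //; exists e => //; move: h2; rewrite mem_enum powersetE.
by exists (w', e); split; rewrite //= mem_enum powersetE.
Qed.

Lemma card_free_digits m : a m <= d -> #|free_digits m| = a m.
Proof.
move=> ad; have wI : injective (widen_ord ad).
  by move=> i j /(congr1 val) /= /val_inj.
rewrite -[RHS]card_ord -(card_imset _ wI).
apply: eq_card => i; rewrite inE; apply/idP/imsetP => [ia|[j _ ->]]; last exact: (ltn_ord j).
by exists (Ordinal ia) => //; apply: val_inj.
Qed.

Lemma size_digit_words p n : (forall m, a m <= d) ->
  size (digit_words p n) = 2 ^ (\sum_(p <= m < p + n) a m).
Proof.
move=> ad; elim: n => [|n IH]; first by rewrite addn0 big_geq.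
rewrite /= size_allpairs IH -cardE card_powerset card_free_digits//.
by rewrite addnS big_nat_recr ?leq_addr//= expnD.
Qed.

Lemma uniq_digit_words p n : uniq (digit_words p n).
Proof.
elim: n => // n IH; apply: allpairs_uniq => //; first exact: enum_uniq.
move=> [w e] [w' e'] _ _ /= /ffunP h.
have h' i : w i = w' i /\ (i \in e) = (i \in e').
  have := h i; rewrite !ffunE; case: (i \in e); case: (i \in e') => /= hi;
    by split; [lia | first [by [] | exfalso; lia]].
congr (_, _); first by apply/ffunP => i; have [] := h' i.
by apply/setP => i; have [] := h' i.
Qed.

Lemma digit_words_lt p n w i : w \in digit_words p n -> w i < 2 ^ n.
Proof.
elim: n w => [|n IH] w; first by rewrite inE => /eqP ->; rewrite ffunE.
move=> /digit_wordsS[w' w'n [e _ ->]]; rewrite ffunE expnS.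
by have := IH _ w'n; case: (i \in e); lia.
Qed.

Lemma zero_digit_word p n : [ffun=> 0] \in digit_words p n.
Proof.
elim: n => [|n IH]; first by rewrite inE.
apply/digit_wordsS; exists [ffun=> 0] => //; exists finset.set0; first exact: finset.sub0set.
by apply/ffunP => i; rewrite !ffunE inE.
Qed.

Lemma digit_words_split p n w : w \in digit_words 0 (p + n) ->
  exists2 u, u \in digit_words 0 p & exists2 v, v \in digit_words p n &
    forall i, w i = 2 ^ n * u i + v i.
Proof.
elim: n w => [|n IH] w.
  rewrite addn0 => wp; exists w => //; exists [ffun=> 0]; first by rewrite inE.
  by move=> i; rewrite ffunE mul1n addn0.
rewrite addnS => /digit_wordsS[w' /IH[u up [v vn w'E]] [e ep ->]].
exists u => //; exists [ffun i => 2 * v i + (i \in e)].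
  by apply/digit_wordsS; exists v => //; exists e.
by move=> i; rewrite !ffunE w'E expnS; lia.
Qed.

Lemma digit_words_cat p n u v : u \in digit_words 0 p -> v \in digit_words p n ->
  [ffun i => 2 ^ n * u i + v i] \in digit_words 0 (p + n).
Proof.
move=> up; elim: n v => [|n IH] v.
  rewrite inE => /eqP ->; rewrite addn0.
  have -> // : [ffun i => 2 ^ 0 * u i + [ffun=> 0] i] = u.
  by apply/ffunP => i; rewrite !ffunE mul1n addn0.
move=> /digit_wordsS[v' /IH h [e ep ->]]; rewrite addnS.
apply/digit_wordsS; exists [ffun i => 2 ^ n * u i + v' i] => //; exists e => //.
by apply/ffunP => i; rewrite !ffunE expnS; lia.
Qed.

End digit_words.

Section euclidean_balls.
Variables (R : realType) (d : nat).
Implicit Types x y : 'rV[R]_d.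

Lemma euclid_norm_le y (c : R) : 0 <= c -> (forall i, `|y ord0 i| <= c) ->
  euclid_norm y <= d%:R * c.
Proof.
move=> c0 yc; have dc0 : 0 <= d%:R * c by rewrite mulr_ge0.
rewrite /euclid_norm -[leRHS]ger0_norm// -sqrtr_sqr; apply: ler_wsqrtr.
apply: (@le_trans _ _ (\sum_(i < d) c ^+ 2)).
  apply: ler_sum => i _; rewrite -[_ ^+ 2]ger0_norm ?sqr_ge0// normrX.
  by rewrite ler_pXn2r// nnegrE.
rewrite sumr_const card_ord -[leLHS]mulr_natl exprMn.
apply: ler_wpM2r; first exact: sqr_ge0.
rewrite -natrX ler_nat; case: (d) => // n; exact: leq_pmulr.
Qed.

Lemma coord_le_euclid_norm y i : `|y ord0 i| <= euclid_norm y.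
Proof.
rewrite /euclid_norm -sqrtr_sqr; apply: ler_wsqrtr.
by rewrite (bigD1 i)//= lerDl sumr_ge0// => j _; exact: sqr_ge0.
Qed.

Lemma covering_number_le_size (delta : R) (E : set 'rV[R]_d) (s : seq 'rV[R]_d) :
  (forall y, E y -> exists2 c, c \in s & euclid_ball c delta y) ->
  (covering_number delta E <= (size s)%:R%:E)%E.
Proof.
move=> sE; apply: ereal_inf_lbound; exists (size s) => //.
exists (fun i => nth 0 s i) => y /sE[c cs cy].
have ci : (index c s < size s)%N by rewrite index_mem.
by exists (Ordinal ci) => //=; rewrite nth_index.
Qed.

(** No ball contains two points of [s], so choosing a ball for each point is injective. *)
Lemma size_le_covering_number (delta : R) (E : set 'rV[R]_d) (s : seq 'rV[R]_d) :
  uniq s -> (forall y, y \in s -> E y) ->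
  (forall c y z, y \in s -> z \in s -> euclid_ball c delta y ->
    euclid_ball c delta z -> y = z) ->
  ((size s)%:R%:E <= covering_number delta E)%E.
Proof.
move=> us sE sep; apply: le_ereal_inf_tmp => _ [n [c cE] <-].
rewrite lee_fin ler_nat.
have /choice[h hP] : forall i : 'I_(size s), exists j : 'I_n,
    euclid_ball (c j) delta (nth 0 s i).
  by move=> i; have [j _ hj] := cE _ (sE _ (mem_nth 0 (ltn_ord i))); exists j.
have hI : injective h.
  move=> i j hij; apply: val_inj; apply/eqP.
  rewrite -(nth_uniq 0 (ltn_ord i) (ltn_ord j) us); apply/eqP.
  apply: (sep (c (h i))); [exact: mem_nth|exact: mem_nth|exact: hP|].
  by rewrite hij; exact: hP.
by have := leq_card _ hI; rewrite !card_ord.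
Qed.

End euclidean_balls.

Lemma absz_near (u t : int) : t - 2 < u -> u < t + 2 ->
  (absz (u - (t - 1))%R < 3)%N /\ t - 1 <= u.
Proof.
move=> h1 h2; have h : t - 1 <= u by lia.
by split=> //; rewrite -ltz_nat gez0_abs; lia.
Qed.

Section moran_set.
Variables (R : realType) (d : nat) (a : nat -> nat).
Hypothesis a_le : forall m, (a m <= d)%N.

Definition dyadic_cell (n : nat) (w : {ffun 'I_d -> nat}) : set 'rV[R]_d :=
  [set x | forall i, (w i)%:R <= 2 ^+ n * x ord0 i <= (w i)%:R + 1].

(** Quantifying over the levels presents the set as an intersection of finite unions of closed
    cells, whence its compactness. *)
Definition moran_set : set 'rV[R]_d :=
  [set x | forall n, exists2 w, w \in digit_words d a 0 n & dyadic_cell n w x].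

Let pow_gt0 n : 0 < 2 ^+ n :> R. Proof. exact: exprn_gt0. Qed.

Lemma closed_dyadic_cell n w : closed (dyadic_cell n w).
Proof.
have n0 := pow_gt0 n.
have -> : dyadic_cell n w = \bigcap_i ((fun x : 'rV[R]_d => x ord0 i) @^-1`
    `[(w i)%:R / 2 ^+ n, ((w i)%:R + 1) / 2 ^+ n]%classic).
  apply/seteqP; split => [x h i _ /=|x h i].
    by rewrite in_itv/= ler_pdivrMr// ler_pdivlMr// ![_ * 2 ^+ n]mulrC; exact: h.
  by have := h i I; rewrite /= in_itv/= ler_pdivrMr// ler_pdivlMr// ![_ * 2 ^+ n]mulrC.
apply: closed_bigI => i _; apply: preimage_closed; last by apply: interval_closed.
by move=> x _; exact: coord_continuous.
Qed.

Lemma compact_moran_set : compact moran_set.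
Proof.
have sub : moran_set `<=` [set v | forall i, `[0, 1]%classic (v ord0 i)].
  move=> x /(_ 0%N)[w]; rewrite inE => /eqP -> h i /=.
  by have := h i; rewrite ffunE expr0 mul1r add0r in_itv.
have cube : compact [set v : 'rV[R]_d | forall i, `[0, 1]%classic (v ord0 i)].
  refine (@rV_compact R d (fun=> `[0, 1]%classic) _).
  by move=> i; exact: segment_compact.
apply: (subclosed_compact _ cube sub).
have -> : moran_set =
    \bigcap_n \bigcup_(w in [set` digit_words d a 0 n]) dyadic_cell n w.
  apply/seteqP; split => [x h n _|x h n].
    by have [w wn wx] := h n; exists w.
  by have [w wn wx] := h n I; exists w.
apply: closed_bigI => n _; apply: closed_bigcup; first exact: finite_seq.
by move=> w _; exact: closed_dyadic_cell.
Qed.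

(** The corner lies in a cell of every level: append zero digits for finer levels, cut the word for
    coarser ones. *)
Lemma digit_word_in_moran_set q w : w \in digit_words d a 0 q ->
  moran_set (\row_i ((w i)%:R / 2 ^+ q)).
Proof.
move=> wq m; have q0 := pow_gt0 q; have m0 := pow_gt0 m.
have [qm|mq] := leqP q m.
  move: qm => /subnKC; move: (m - q)%N => n <- {m m0}.
  exists [ffun i => (2 ^ n * w i + [ffun=> 0%N] i)%N].
    by apply: digit_words_cat => //; exact: zero_digit_word.
  move=> i; rewrite !ffunE !mxE addn0 natrM natrX exprD.
  have -> : 2 ^+ q * 2 ^+ n * ((w i)%:R / 2 ^+ q) = 2 ^+ n * (w i)%:R :> R.
    by field; rewrite gt_eqF.
  by rewrite lexx lerDl ler01.
move: (mq) => /ltnW /subnKC; move: (q - m)%N => n qE; rewrite -qE in wq.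
have [u um [v vn wE]] := digit_words_split _ _ _ _ _ wq.
exists u => // i; rewrite mxE wE -qE exprD natrD natrM natrX.
have n0 := pow_gt0 n.
have -> : 2 ^+ m * ((2 ^+ n * (u i)%:R + (v i)%:R) / (2 ^+ m * 2 ^+ n)) =
    (u i)%:R + (v i)%:R / 2 ^+ n :> R by field; rewrite !gt_eqF.
apply/andP; split; first by rewrite lerDl divr_ge0// ltW.
rewrite lerD2l ler_pdivrMr// mul1r -natrX ler_nat.
exact: ltnW (digit_words_lt _ _ _ _ _ i vn).
Qed.

Lemma moran_set0 : moran_set 0.
Proof.
have := digit_word_in_moran_set 0 _ (zero_digit_word _ _ 0 0).
have -> // : \row_i ((([ffun=> 0%N] : {ffun 'I_d -> nat}) i)%:R / 2 ^+ 0) = 0 :> 'rV[R]_d.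
  by apply/rowP => i; rewrite !mxE ffunE mul0r.
Qed.

(** In each coordinate the ball meets only level-[p] cells whose index differs by at most 1 from the
    floor of [2 ^+ p * x], hence [3 ^ d]. The digits available from place [p] on are the same in all
    cells, and a ball of radius [delta'] about the corner of a level-[(p + n)] cell contains that
    cell. *)
Lemma covering_number_le p n (delta delta' : R) (x : 'rV[R]_d) :
  delta * 2 ^+ p <= 1 -> d%:R < delta' * 2 ^+ (p + n) ->
  (covering_number delta' (moran_set `&` euclid_ball x delta) <=
     (3 ^ d * 2 ^ (\sum_(p <= m < p + n) a m))%:R%:E)%E.
Proof.
move=> dp dq; have q0 := pow_gt0 (p + n); have p0 := pow_gt0 p; have n0 := pow_gt0 n.
pose z i := Num.floor (2 ^+ p * x ord0 i).
pose center (o : {ffun 'I_d -> 'I_3}) (v : {ffun 'I_d -> nat}) : 'rV[R]_d :=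
  \row_i (((z i - 1 + (o i)%:Z)%:~R * 2 ^+ n + (v i)%:R) / 2 ^+ (p + n)).
have -> : (3 ^ d * 2 ^ (\sum_(p <= m < p + n) a m))%N =
    size [seq center o v | o <- enum {ffun 'I_d -> 'I_3}, v <- digit_words d a p n].
  by rewrite size_allpairs size_digit_words// -cardE card_ffun !card_ord.
apply: covering_number_le_size => y [Fy yx].
have [w wq wy] := Fy (p + n)%N.
have [u up [v vn wE]] := digit_words_split _ _ _ _ _ wq.
have ub i : [/\ (u i)%:R <= 2 ^+ p * y ord0 i, 2 ^+ p * y ord0 i <= (u i)%:R + 1 &
    0 <= 2 ^+ (p + n) * y ord0 i - (2 ^+ n * (u i)%:R + (v i)%:R) <= 1].
  have := wy i; rewrite wE natrD natrM natrX => h.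
  have := digit_words_lt _ _ _ _ _ i vn; rewrite -(ler_nat R) -natr1 natrX => h'.
  have v0 : 0 <= (v i)%:R :> R by [].
  by split; [rewrite -(ler_pM2l n0) mulrA -exprD addnC; lra
    | rewrite -(ler_pM2l n0) mulrA -exprD addnC; lra | lra].
have off i : (absz ((u i)%:Z - (z i - 1))%R < 3)%N /\ (z i - 1 <= (u i)%:Z).
  have [u1 u2 _] := ub i.
  have : `|y ord0 i - x ord0 i| < delta.
    by have := coord_le_euclid_norm _ _ (y - x) i; rewrite !mxE => /le_lt_trans; apply.
  rewrite -(ltr_pM2r p0) => /lt_le_trans /(_ dp) h.
  have {}h : `|2 ^+ p * y ord0 i - 2 ^+ p * x ord0 i| < 1.
    by rewrite -mulrBr normrM gtr0_norm// mulrC.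
  have := floor_itv (2 ^+ p * x ord0 i); rewrite -/(z i).
  move: h; rewrite ltr_norml; move: (2 ^+ p * x ord0 i) (z i) => X t h1.
  rewrite rmorphD /= => h2.
  have h3 : (t - 2)%:~R < (u i)%:Z%:~R :> R by rewrite rmorphB /=; lra.
  have h4 : (u i)%:Z%:~R < (t + 2)%:~R :> R by rewrite rmorphD /=; lra.
  by move: h3 h4; rewrite !ltr_int; exact: absz_near.
exists (center [ffun i => Ordinal (off i).1] v).
  by apply/allpairsP; exists ([ffun i => Ordinal (off i).1], v); rewrite /= mem_enum.
rewrite /euclid_ball /=.
apply: (@le_lt_trans _ _ (d%:R * (2 ^+ (p + n))^-1)); last by rewrite ltr_pdivrMr.
apply: euclid_norm_le => [|i]; first by rewrite invr_ge0 ltW.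
rewrite !mxE ffunE /=.
have -> : (z i - 1 + (absz ((u i)%:Z - (z i - 1))%R)%:Z)%:~R = (u i)%:R :> R.
  by rewrite gez0_abs ?subr_ge0 ?(off i).2// addrC subrK.
rewrite -(ler_pM2l q0) divff ?gt_eqF// -[X in X * `|_|]gtr0_norm// -normrM.
have -> : 2 ^+ (p + n) * (y ord0 i - ((u i)%:R * 2 ^+ n + (v i)%:R) / 2 ^+ (p + n)) =
  2 ^+ (p + n) * y ord0 i - (2 ^+ n * (u i)%:R + (v i)%:R) by field; rewrite gt_eqF.
by have [_ _ /andP[h1 h2]] := ub i; rewrite ger0_norm.
Qed.

(** The corners whose first [p] digits vanish lie in the ball about 0. Distinct ones differ by at
    least [2^-(p + n)] in some coordinate, so an open ball of radius [delta'] contains at most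
    one. *)
Lemma covering_number_ge p n (delta delta' : R) :
  d%:R < delta * 2 ^+ p -> delta' * 2 ^+ (p + n) <= 1 / 2 ->
  ((2 ^ (\sum_(p <= m < p + n) a m))%:R%:E <=
     covering_number delta' (moran_set `&` euclid_ball 0 delta))%E.
Proof.
move=> dp dq; have q0 := pow_gt0 (p + n); have p0 := pow_gt0 p; have n0 := pow_gt0 n.
pose pt (v : {ffun 'I_d -> nat}) : 'rV[R]_d := \row_i ((v i)%:R / 2 ^+ (p + n)).
have ptI : injective pt.
  move=> v v' /rowP h; apply/ffunP => i; have := h i; rewrite !mxE.
  have qU : (2 ^+ (p + n))^-1 != 0 :> R by rewrite invr_neq0// gt_eqF.
  by move=> /(mulIf qU) /eqP; rewrite eqr_nat => /eqP.
rewrite -(size_digit_words d)// -(size_map pt).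
apply: size_le_covering_number.
- by rewrite map_inj_uniq// uniq_digit_words.
- move=> _ /mapP[v vn ->]; split.
    have := digit_word_in_moran_set _ _
      (digit_words_cat _ _ _ _ _ _ (zero_digit_word _ _ 0 p) vn).
    have <- // : pt v = \row_i (([ffun i =>
        (2 ^ n * ([ffun=> 0%N] : {ffun 'I_d -> nat}) i + v i)%N] i)%:R / 2 ^+ (p + n)).
    by apply/rowP => i; rewrite !mxE !ffunE muln0 add0n.
  rewrite /euclid_ball /= subr0.
  apply: (@le_lt_trans _ _ (d%:R * (2 ^+ p)^-1)); last by rewrite ltr_pdivrMr.
  apply: euclid_norm_le => [|i]; first by rewrite invr_ge0 ltW.
  have v0 : 0 <= (v i)%:R / 2 ^+ (p + n) :> R by rewrite divr_ge0// ltW.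
  rewrite mxE ger0_norm// exprD invfM mulrCA.
  rewrite -[leRHS]mulr1 ler_pM2l ?invr_gt0// ler_pdivrMr// mul1r -natrX ler_nat.
  exact: ltnW (digit_words_lt _ _ _ _ _ i vn).
- move=> c _ _ /mapP[v vn ->] /mapP[v' vn' ->] h h'.
  congr pt; apply/ffunP => i.
  have close (w : {ffun 'I_d -> nat}) : euclid_ball c delta' (pt w) ->
      `|(w i)%:R - 2 ^+ (p + n) * c ord0 i| < 1 / 2.
    move=> /(le_lt_trans (coord_le_euclid_norm _ _ _ i)); rewrite !mxE => hw.
    have -> : (w i)%:R - 2 ^+ (p + n) * c ord0 i =
      2 ^+ (p + n) * ((w i)%:R / 2 ^+ (p + n) - c ord0 i) by field; rewrite gt_eqF.
    rewrite normrM gtr0_norm// mulrC; apply: lt_le_trans dq.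
    by rewrite ltr_pM2r.
  have := close _ h; have := close _ h'; rewrite !ltr_norml => h1 h2.
  have : (v i)%:R < (v' i)%:R + 1 :> R by lra.
  have : (v' i)%:R < (v i)%:R + 1 :> R by lra.
  by rewrite !natr1 !ltr_nat !ltnS => h3 h4; apply/eqP; rewrite eqn_leq h3 h4.
Qed.

End moran_set.

(** * The spectrum of the digit set *)

Section powers_of_two.
Variable R : realType.
Implicit Types x y : R.

Lemma ler_powR2 x y : (2 `^ x <= 2 `^ y) = (x <= y).
Proof.
have l2 : 0 < ln (2 : R) by rewrite ln_gt0// ltr1n.
by rewrite /powR gt_eqF// ler_expR ler_pM2r.
Qed.

Lemma powR2D x y : 2 `^ (x + y) = 2 `^ x * 2 `^ y :> R.
Proof. by rewrite powRD// pnatr_eq0 implybT. Qed.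

Lemma powR2_natr (n : nat) : 2 `^ n%:R = 2 ^+ n :> R.
Proof. by rewrite powR_mulrn. Qed.

Lemma exists_powR2 c : 0 < c -> exists x : R, c = 2 `^ x.
Proof.
move=> c0; have l2 : 0 < ln (2 : R) by rewrite ln_gt0// ltr1n.
exists (ln c / ln 2); rewrite /powR gt_eqF// divfK ?gt_eqF//.
by rewrite lnK.
Qed.

End powers_of_two.

Section spectrum.
Variables (R : realType) (d : nat) (a : nat -> nat) (f : R -> R).
Hypothesis f_ge0 : forall x, 0 < x < 1 -> 0 <= f x.
Hypothesis f_down : forall x y, 0 < x -> x <= y -> y <= 1 ->
  (1 - y) * f y <= (1 - x) * f x <= (1 - y) * f y + d%:R * (y - x).
Hypothesis a_le : forall m, (a m <= d)%N.
Let k x := (1 - x) * f x.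
Let S p q : R := (\sum_(p <= m < q) a m)%:R.
Hypothesis S_upper : forall rho : R, 0 < rho -> exists C : R,
  forall p q, (0 < p)%N -> (p < q)%N ->
    rho * q%:R <= p%:R -> S p q <= q%:R * k (p%:R / q%:R) + C.
Hypothesis S_lower : forall rho : R, 0 < rho -> forall N, exists2 q, (N <= q)%N &
  forall p, (0 < p)%N -> (p <= q)%N -> rho * q%:R <= p%:R ->
    q%:R * k (p%:R / q%:R) - 1 <= S p q.

Let S_le p q : S p q <= d%:R * q%:R.
Proof.
rewrite /S -natrM ler_nat (@leq_trans (\sum_(p <= m < q) d))//.
  by apply: leq_sum => m _; exact: a_le.
by rewrite sum_nat_const_nat mulnC leq_mul2l leq_subr orbT.
Qed.

Let k_close x y : 0 < x -> x <= y -> y <= 1 -> k y <= k x <= k y + d%:R * (y - x).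
Proof. exact: f_down. Qed.

Variable theta : R.
Hypothesis theta01 : 0 < theta < 1.

Let k_itv : 0 <= k theta <= d%:R.
Proof.
have th := theta01; have /andP[h1 h2] := k_close theta 1 ltac:(lra) ltac:(lra) (lexx 1).
have : 0 <= d%:R * theta by rewrite mulr_ge0//; lra.
by move: h1 h2; rewrite /k subrr mul0r; lra.
Qed.

(** Here [P] stands for the binary logarithm of [1 / delta]. The bound is [S_upper] with [p / q]
    replaced by [theta], and [C] collects the rounding errors. *)
Let S_bound : exists C : R, forall P p q, 0 <= P -> p%:R <= P -> P < p%:R + 1 ->
  P / theta + d%:R < q%:R -> q%:R <= P / theta + 1 + d%:R ->
  S p q <= (P / theta - P) * f theta + C.
Proof.
have th := theta01; have f0 := f_ge0 _ th.
have th2 : 0 < theta / 2 by lra.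
have [C hC] := S_upper _ th2.
exists (d%:R * ((d%:R + 3) / theta + 1 + d%:R) +
  (d%:R * (d%:R + 2) + d%:R * (1 + d%:R) + `|C|)).
move=> P p q P0 pP Pp qP Pq.
have [h0 h1] := andP k_itv.
have D0 : 0 <= d%:R :> R by [].
have t0 : 0 <= (d%:R + 3) / theta by rewrite divr_ge0//; lra.
have e1 : 0 <= d%:R * ((d%:R + 3) / theta + 1 + d%:R) by rewrite mulr_ge0//; lra.
have e2 : 0 <= d%:R * (d%:R + 2) :> R by rewrite mulr_ge0//; lra.
have e3 : 0 <= d%:R * (1 + d%:R) :> R by rewrite mulr_ge0//; lra.
have Pt : P <= P / theta by rewrite ler_pdivlMr ?ler_piMr//; lra.
(* Above [d + 3] the rounded scales satisfy [theta / 2 * q <= p], as [S_upper] requires; below, [q]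
   is bounded. *)
have [Psmall|Plarge] := leP P (d%:R + 3).
  have e4 : 0 <= (P / theta - P) * f theta by rewrite mulr_ge0//; lra.
  have e5 : d%:R * q%:R <= d%:R * ((d%:R + 3) / theta + 1 + d%:R).
    rewrite ler_wpM2l//; apply: (le_trans Pq).
    have : P / theta <= (d%:R + 3) / theta by rewrite ler_pM2r ?invr_gt0//; lra.
    lra.
  by have := S_le p q; have := normr_ge0 C; lra.
have p0 : 0 < p%:R :> R by lra.
have pq : p%:R < q%:R :> R by lra.
have q0 : 0 < q%:R :> R by lra.
have tq : theta * q%:R <= P + theta * (1 + d%:R).
  have -> : P + theta * (1 + d%:R) = theta * (P / theta + 1 + d%:R).
    by field; rewrite gt_eqF//; lra.
  by rewrite ler_pM2l//; lra.
have tq' : theta * (1 + d%:R) <= 1 + d%:R by rewrite ler_piMl//; lra.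
have := hC p q; rewrite -(ltr0n R) -(ltr_nat R) p0 pq => /(_ isT isT ltac:(lra)) h.
have h2 : q%:R * k (p%:R / q%:R) <= q%:R * k theta + d%:R * (d%:R + 2).
  have [pt|tp] := leP (p%:R / q%:R) theta.
    have /andP[_ h3] := k_close (p%:R / q%:R) theta ltac:(by rewrite divr_gt0) pt ltac:(lra).
    have h4 : q%:R * k (p%:R / q%:R) <= q%:R * (k theta + d%:R * (theta - p%:R / q%:R)).
      by rewrite ler_pM2l.
    apply: (le_trans h4); rewrite mulrDr lerD2l mulrCA ler_wpM2l//.
    by rewrite mulrBr [q%:R * (p%:R / q%:R)]mulrC divfK ?gt_eqF//; lra.
  have pq1 : p%:R / q%:R <= 1 :> R by rewrite ler_pdivrMr// mul1r ltW.
  have /andP[h3 _] := k_close theta (p%:R / q%:R) ltac:(lra) (ltW tp) pq1.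
  have : q%:R * k (p%:R / q%:R) <= q%:R * k theta by rewrite ler_pM2l.
  lra.
have h5 : q%:R * k theta <= (P / theta + 1 + d%:R) * k theta by rewrite ler_wpM2r.
have h6 : P / theta * k theta = (P / theta - P) * f theta.
  by rewrite /k; field; rewrite gt_eqF//; lra.
have h7 : (1 + d%:R) * k theta <= (1 + d%:R) * d%:R by rewrite ler_wpM2l//; lra.
by have := ler_norm C; lra.
Qed.

Lemma assouad_spectrum_le : (assouad_spectrum (moran_set R d a) theta <= (f theta)%:E)%E.
Proof.
have th := theta01; have [C hC] := S_bound.
apply: ereal_inf_lbound; exists (f theta) => //.
exists (3 ^+ d * 2 `^ C); first by rewrite mulr_gt0 ?exprn_gt0 ?powR_gt0.
move=> delta delta0 delta1 x _.
have [P' dE] := exists_powR2 _ _ delta0; rewrite -[P']opprK in dE.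
move: (- P') dE => P dE {P'}.
have P0 : 0 <= P.
  by move: delta1; rewrite dE -[leRHS](powRr0 2) ler_powR2 oppr_le0.
have dE' : delta `^ theta^-1 = 2 `^ (- (P / theta)) by rewrite dE -powRrM mulNr.
have Pt : P <= P / theta by rewrite ler_pdivlMr ?ler_piMr//; lra.
(* The extra [d] places beat the factor [d] in the Euclidean diameter of a cell, as [d < 2 ^ d]. *)
pose p := Num.truncn P; pose q := (Num.truncn (P / theta) + 1 + d)%N.
have /andP[pP Pp] := truncn_itv P0; rewrite -/p -natr1 in pP Pp.
have Pt0 : 0 <= P / theta by lra.
have /andP[qP Pq] := truncn_itv Pt0; rewrite -natr1 in Pq.
have qE : q%:R = (Num.truncn (P / theta))%:R + 1 + d%:R :> R by rewrite !natrD.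
have pq : (p <= q)%N by rewrite -(ler_nat R) qE; have : 0 <= d%:R :> R by []; lra.
have qn : (p + (q - p))%N = q by rewrite subnKC.
apply: le_trans (covering_number_le R d a a_le p (q - p) delta _ x _ _) _.
- by rewrite dE -powR2_natr -powR2D -[leRHS](powRr0 2) ler_powR2; lra.
- rewrite qn dE' -powR2_natr -powR2D.
  apply: (@lt_le_trans _ _ (2 `^ d%:R)); last by rewrite ler_powR2; lra.
  by rewrite powR2_natr -natrX ltr_nat ltn_expl.
rewrite qn lee_fin natrM !natrX -mulrA ler_pM2l ?exprn_gt0// -powR2_natr.
have -> : delta / delta `^ theta^-1 = 2 `^ (P / theta - P).
  by rewrite dE' dE -powRN opprK -powR2D addrC.
rewrite -powRrM -powR2D ler_powR2 [C + _]addrC.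
by apply: hC => //; rewrite qE; lra.
Qed.

Lemma assouad_spectrum_ge : ((f theta)%:E <= assouad_spectrum (moran_set R d a) theta)%E.
Proof.
have th := theta01.
apply: le_ereal_inf_tmp => _ [alpha [C C0 hC] <-]; rewrite lee_fin leNgt.
apply/negP => af.
have [c cE] := exists_powR2 _ _ C0.
pose gamma := (1 - theta) * (f theta - alpha).
have g0 : 0 < gamma by rewrite mulr_gt0//; lra.
(* The bounded errors: replacing [p / q] by [theta], the 1 of [S_lower], [q + 1] in place of [q],
   and the logarithm of [C]. In [N] below, the first summand ensures [p <= q], the second that
   [gamma * q] exceeds [D]. *)
pose D := d%:R * (d%:R + 2) + 1 + (1 - theta) * alpha + c.
pose N := (Num.bound ((2 + d%:R) / (1 - theta)) + Num.bound (`|D| / gamma))%N.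
have [q Nq hq] := S_lower _ (proj1 (andP th)) N.
have D0 : 0 <= d%:R :> R by [].
have Nq' : N%:R <= q%:R :> R by rewrite ler_nat.
have q1 : 2 + d%:R < (1 - theta) * q%:R.
  rewrite -ltr_pdivrMl ?subr_gt0; last lra.
  rewrite mulrC; apply: lt_le_trans Nq'; rewrite natrD.
  have : (2 + d%:R) / (1 - theta) < (Num.bound ((2 + d%:R) / (1 - theta)))%:R.
    by rewrite archi_boundP// divr_ge0//; lra.
  by have : 0 <= (Num.bound (`|D| / gamma))%:R :> R by []; lra.
have q2 : D < gamma * q%:R.
  apply: (le_lt_trans (ler_norm D)); rewrite -ltr_pdivrMl//.
  rewrite mulrC; apply: lt_le_trans Nq'; rewrite natrD.
  have : `|D| / gamma < (Num.bound (`|D| / gamma))%:R.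
    by rewrite archi_boundP// divr_ge0// ltW.
  by have : 0 <= (Num.bound ((2 + d%:R) / (1 - theta)))%:R :> R by []; lra.
have q0 : 0 < q%:R :> R by rewrite -(pmulr_rgt0 _ (_ : 0 < 1 - theta)); lra.
pose P := (q%:R + 1) * theta.
have P0 : 0 <= P by rewrite mulr_ge0//; lra.
pose p := (Num.truncn P + 1 + d)%N.
have /andP[pP Pp] := truncn_itv P0; rewrite -natr1 in Pp.
have pE : p%:R = (Num.truncn P)%:R + 1 + d%:R :> R by rewrite !natrD.
have pq : (p <= q)%N by rewrite -(ler_nat R) pE; move: pP Pp; rewrite /P; lra.
have p0 : (0 < p)%N by rewrite -(ltr0n R) pE; lra.
have tp : theta * q%:R <= p%:R by rewrite pE; move: pP Pp; rewrite /P; lra.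
have hS := hq p p0 pq tp.
have tpq : theta <= p%:R / q%:R by rewrite ler_pdivlMr.
have pq1 : p%:R / q%:R <= 1 :> R by rewrite ler_pdivrMr// mul1r ler_nat.
have /andP[_ h1] := k_close _ _ (proj1 (andP th)) tpq pq1.
have h2 : q%:R * k theta <= q%:R * k (p%:R / q%:R) + d%:R * (d%:R + 2).
  have h3 : q%:R * k theta <= q%:R * (k (p%:R / q%:R) + d%:R * (p%:R / q%:R - theta)).
    by rewrite ler_pM2l.
  apply: (le_trans h3); rewrite mulrDr lerD2l mulrCA ler_wpM2l//.
  rewrite mulrBr [q%:R * (p%:R / q%:R)]mulrC divfK ?gt_eqF// pE.
  by move: pP; rewrite /P; lra.
pose delta := 2 `^ (- P).
have delta0 : 0 < delta by rewrite powR_gt0.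
have delta1 : delta <= 1 by rewrite -[leRHS](powRr0 2) ler_powR2 oppr_le0.
have dE : delta `^ theta^-1 = 2 `^ (- (q%:R + 1)).
  by rewrite /delta -powRrM /P mulNr mulfK// gt_eqF//; lra.
have qn : (p + (q - p))%N = q by rewrite subnKC.
have := hC delta delta0 delta1 0 (moran_set0 R d a).
rewrite leNgt => /negP; apply.
apply: lt_le_trans (covering_number_ge R d a a_le p (q - p) delta _ _ _).
- rewrite lte_fin.
  have -> : delta / delta `^ theta^-1 = 2 `^ ((q%:R + 1) * (1 - theta)).
    by rewrite dE /delta -powRN opprK -powR2D /P; congr (_ `^ _); ring.
  rewrite qn cE -powRrM -powR2D natrX -powR2_natr ltNge ler_powR2 -ltNge.
  move: hS h2 q2; rewrite /S /D /gamma /k; lra.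
- apply: (@lt_le_trans _ _ (2 `^ d%:R)).
    by rewrite powR2_natr -natrX ltr_nat ltn_expl.
  by rewrite /delta -powR2_natr -powR2D ler_powR2 pE; lra.
- rewrite qn dE -powR2_natr -powR2D.
  have -> : - (q%:R + 1) + q%:R = -1 :> R by ring.
  by rewrite powR_inv1// div1r.
Qed.

Lemma assouad_spectrum_moran_set :
  assouad_spectrum (moran_set R d a) theta = (f theta)%:E.
Proof.
by apply/eqP; rewrite eq_le assouad_spectrum_le assouad_spectrum_ge.
Qed.

End spectrum.

(** * The digit set of a profile close to [varphi] *)

Theorem theoremE (R : realType) (d : nat) (hd : (0 < d)%N)
  (eps : R) (heps : 0 < eps) (varphi : R -> R)
  (hrange : forall theta : R, 0 < theta < 1 -> 0 <= varphi theta <= d%:R)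
  (hincr : {in `]0, 1[ &, nondecreasing_fun varphi})
  (hdecr : {in `]0, 1[ &,
     nonincreasing_fun (fun theta : R => (1 - theta) * varphi theta)}) :
  exists F : set 'rV[R]_d,
    [/\ compact F,
        forall U : set R, open U -> U !=set0 -> U `<=` `]0, 1[ ->
          ~ monotone_on U (assouad_spectrum F)
      & (sup_norm01 (fun theta : R =>
           assouad_spectrum F theta - (varphi theta)%:E) < eps%:E)%E].
Proof.
have D1 : 1 <= d%:R :> R by rewrite ler1n.
(* The supremum preserves only weak bounds, so the profile is taken within [eps / 2]. *)
have e2 : 0 < eps / 2 by lra.
have phi_up x y : 0 < x -> x <= y -> y < 1 -> varphi x <= varphi y.
  by move=> x0 xy y1; apply: hincr => //; rewrite in_itv/=; lra.
have phi_down x y : 0 < x -> x <= y -> y < 1 ->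
    (1 - y) * varphi y <= (1 - x) * varphi x.
  by move=> x0 xy y1; apply: (hdecr x y) => //; rewrite in_itv/=; lra.
have [f [f0 f_down f_window f_close f_osc]] :=
  exists_profile R d%:R (eps / 2) varphi D1 e2 hrange phi_up phi_down.
have k1 : (1 - 1) * f 1 = 0 by rewrite subrr mul0r.
have [a [a_le S_upper S_lower]] :=
  exists_digit_counts R d (fun x => (1 - x) * f x) f_down k1 f_window.
have spectrum theta : 0 < theta < 1 ->
    assouad_spectrum (moran_set R d a) theta = (f theta)%:E.
  exact: (assouad_spectrum_moran_set R d a f f0 f_down a_le S_upper S_lower).
exists (moran_set R d a); split; first exact: compact_moran_set.
- move=> U Uo [x Ux] U01.
  have [e /= e0 eU] : exists2 e : R, 0 < e & ball x e `<=` U.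
    by apply/nbhs_ballP; exact: open_nbhs_nbhs.
  have inU y : x - e / 2 <= y <= x + e / 2 -> U y.
    by move=> hy; apply: eU; rewrite /ball /= ltr_norml; lra.
  have in01 y : U y -> 0 < y < 1 by move=> /U01; rewrite /= in_itv.
  have u0 : 0 <= x - e / 2 by have := in01 _ (inU (x - e / 2) ltac:(lra)); lra.
  have v1 : x + e / 2 <= 1 by have := in01 _ (inU (x + e / 2) ltac:(lra)); lra.
  have uv : x - e / 2 < x + e / 2 by lra.
  case=> mono.
    have [y [z [uy yz zv]]] := f_osc false _ _ u0 uv v1.
    have Uy := inU y ltac:(lra); have Uz := inU z ltac:(lra).
    have := mono y z ltac:(by rewrite inE) ltac:(by rewrite inE) (ltW yz).
    by rewrite !spectrum ?in01// lee_fin leNgt => /negP.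
  have [y [z [uy yz zv]]] := f_osc true _ _ u0 uv v1.
  have Uy := inU y ltac:(lra); have Uz := inU z ltac:(lra).
  have := mono y z ltac:(by rewrite inE) ltac:(by rewrite inE) (ltW yz).
  by rewrite !spectrum ?in01// lee_fin leNgt => /negP.
- apply: (@le_lt_trans _ _ (eps / 2)%:E); last by rewrite lte_fin; lra.
  apply: ge_ereal_sup => _ [theta th <-].
  have th01 : 0 < theta < 1 by move: th; rewrite /= in_itv.
  by rewrite spectrum// -EFinB abse_EFin lee_fin f_close.
Qed.
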